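(* Let $\mathcal{H}$ be a complex Hilbert space, let $A\in\mathcal{B}(\mathcal{H})$ be a positive operator such that $mI\le A\le MI$ for some scalars $0<m<M$, and let $\Phi$ be a normalized positive linear map on $\mathcal{B}(\mathcal{H})$. In the following, scalars appearing in operator inequalities are understood as multiples of $I$. (i) If $0\le r\le 1$, then \[ \begin{aligned} \left(\frac{M+m}{2\sqrt{Mm}}\right)^{r}&\ge \left(\frac{\frac{1}{\sqrt{Mm}}\Phi(A)+\sqrt{Mm}\,\Phi(A^{-1})}{2}\right)^{r}\\ &\ge \frac{\frac{1}{(Mm)^{r/2}}\Phi(A)^{r}+(Mm)^{r/2}\,\Phi(A^{-1})^{r}}{2}\\ &\ge \Phi(A)^{r}\,\sharp\,\Phi(A^{-1})^{r}. \end{aligned} \] In particular, for $r=1$, \[ \frac{M+m}{2\sqrt{Mm}}\ge \frac{\frac{1}{\sqrt{Mm}}\Phi(A)+\sqrt{Mm}\,\Phi(A^{-1})}{2}\ge \Phi(A)\,\sharp\,\Phi(A^{-1}). \] (ii) If $-1\le r\le 0$, then \[ \begin{aligned} \left(\frac{M+m}{2\sqrt{Mm}}\right)^{r}&\le \left(\frac{\frac{1}{\sqrt{Mm}}\Phi(A)+\sqrt{Mm}\,\Phi(A^{-1})}{2}\right)^{r}\\ &\le \left\{\frac{(Mm)^{r}\,\Phi(A)^{-r}+\Phi(A^{-1})^{-r}}{2(Mm)^{r/2}}\right\}^{-1}\\ &\le \Phi(A)^{r}\,\sharp\,\Phi(A^{-1})^{r}. \end{aligned} \]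
   Context: $\mathcal{B}(\mathcal{H})$ is the algebra of bounded linear operators on $\mathcal{H}$, with identity $I$. $A\ge 0$ (positive) means $\langle Ax,x\rangle\ge 0$ for all $x\in\mathcal{H}$; strictly positive means positive and invertible; $B\ge A$ means $B-A\ge 0$. A positive linear map $\Phi$ on $\mathcal{B}(\mathcal{H})$ is a linear map $\mathcal{B}(\mathcal{H})\to\mathcal{B}(\mathcal{H})$ with $\Phi(A)\ge 0$ whenever $A\ge 0$; it is normalized if $\Phi(I)=I$. For strictly positive $A,B$, the geometric mean is $A\sharp B=A^{1/2}(A^{-1/2}BA^{-1/2})^{1/2}A^{1/2}$. The notation $\Phi(X)^r$ means $(\Phi(X))^r$. *)

(* Defs.v *)
From HB Require Import structures.
From mathcomp Require Import all_boot all_order all_algebra.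
From mathcomp Require Import sesquilinear complex.
From mathcomp Require Import all_classical all_reals all_analysis.
Import Order.TTheory GRing.Theory Num.Theory.
Import numFieldNormedType.Exports.

Set Implicit Arguments.
Unset Strict Implicit.
Unset Printing Implicit Defensive.

Local Open Scope classical_set_scope.
Local Open Scope complex_scope.
Local Open Scope ring_scope.

(* The norm of a normed module over R[i] takes its values in R[i]; the inner
   product is linear in its first argument and conjugate-linear in the
   second. *)
HB.mixin Record CompleteNormedModule_isHilbert (R : realType) H
    of CompleteNormedModule R[i] H := {
  inner : {dot H for @Num.conj R[i]} ;
  inner_norm : forall x : H, inner x x = `|x| ^+ 2
}.

#[short(type="hilbertType")]
HB.structure Definition Hilbert (R : realType) :=
  {H of CompleteNormedModule R[i] H & CompleteNormedModule_isHilbert R H}.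

Section BoundedOperators.
Context {R : realType} {H : hilbertType R}.
Local Notation C := R[i].

Definition bounded_linear (f : H -> H) :=
  (forall (a : C) (x y : H), f (a *: x + y) = a *: f x + f y) /\
  exists K : C, forall x : H, `|f x| <= K * `|x|.

Definition is_bop : {pred H -> H} := fun f => `[< bounded_linear f >].

Lemma is_bopP (f : H -> H) : reflect (bounded_linear f) (f \in is_bop).
Proof. exact: asboolP. Qed.

Lemma is_bop_submod : submod_closed is_bop.
Proof.
split=> [|a f g].
  have f0 (x : H) : (0 : H -> H) x = 0 by [].
  apply/is_bopP; split=> [a x y|]; first by rewrite !f0 scaler0 addr0.
  by exists 0 => x; rewrite f0 normr0 mul0r.
move=> /is_bopP[lf [K fK]] /is_bopP[lg [L gL]]; apply/is_bopP; split.
  have E x : (a *: f + g) x = a *: f x + g x by [].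
  move=> b x y; rewrite !E lf lg !scalerDr !scalerA (mulrC a b).
  by rewrite addrACA.
exists (`|a| * K + L) => x.
rewrite (le_trans (ler_normD _ _))// mulrDl lerD// normrZ -mulrA.
by rewrite ler_wpM2l.
Qed.

HB.instance Definition _ := GRing.isSubmodClosed.Build C (H -> H) is_bop
  is_bop_submod.

End BoundedOperators.

(* The algebra B(H); products are compositions. *)
Record bop {R : realType} (H : hilbertType R) :=
  Bop { bop_fun :> H -> H ; bop_subproof : bop_fun \in is_bop }.
Arguments bop {R} H.

Section BopStructure.
Context {R : realType} {H : hilbertType R}.
Local Notation C := R[i].

HB.instance Definition _ := [isSub for @bop_fun R H].
HB.instance Definition _ := [Choice of bop H by <:].
HB.instance Definition _ := [SubChoice_isSubLmodule of bop H by <:].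

Lemma bopP (S T : bop H) : S =1 T -> S = T.
Proof. by move=> ST; apply/val_inj/funext. Qed.

Lemma bop_is_linear (S : bop H) (a : C) (x y : H) :
  S (a *: x + y) = a *: S x + S y.
Proof. by case: S => f /= /is_bopP[]. Qed.

Lemma bop_bounded (S : bop H) :
  exists K : C, forall x : H, `|S x| <= K * `|x|.
Proof. by case: S => f /= /is_bopP[]. Qed.

Lemma bop1_subproof : (id : H -> H) \in is_bop.
Proof. by apply/is_bopP; split=> //; exists 1 => x; rewrite mul1r. Qed.

Lemma bopM_subproof (S T : bop H) : (S \o T : H -> H) \in is_bop.
Proof.
apply/is_bopP; split=> [a x y|] /=; first by rewrite !bop_is_linear.
have [K SK] := bop_bounded S; have [L TL] := bop_bounded T.
exists (`|K| * L) => x; rewrite (le_trans (SK _))//.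
have [x0|x0] := eqVneq (T x) 0.
  by rewrite x0 normr0 mulr0 -mulrA mulr_ge0// (le_trans _ (TL x)).
rewrite -mulrA (@le_trans _ _ (`|K| * `|T x|))//; last by rewrite ler_wpM2l.
have K0 : 0 <= K * `|T x| by rewrite (le_trans _ (SK _)).
by rewrite -(ger0_norm K0) normrM normr_id.
Qed.

Definition bop1 : bop H := Bop bop1_subproof.
Definition bopM (S T : bop H) : bop H := Bop (bopM_subproof S T).

Lemma bopMA : associative bopM. Proof. by move=> S T U; apply: bopP. Qed.
Lemma bop1M : left_id bop1 bopM. Proof. by move=> S; apply: bopP. Qed.
Lemma bopM1 : right_id bop1 bopM. Proof. by move=> S; apply: bopP. Qed.
Lemma bopMDl : left_distributive bopM +%R.
Proof. by move=> S T U; apply: bopP. Qed.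
Lemma bopMDr : right_distributive bopM +%R.
Proof.
move=> S T U; apply: bopP => x /=.
by have /= := bop_is_linear S 1 (T x) (U x); rewrite !scale1r.
Qed.

HB.instance Definition _ := GRing.Zmodule_isPzRing.Build (bop H)
  bopMA bop1M bopM1 bopMDl bopMDr.

End BopStructure.

Section Positivity.
Context {R : realType} {H : hilbertType R}.
Local Notation C := R[i].
Implicit Types S T : bop H.

(* In R[i], 0 <= z means that z is real and nonnegative. *)
Definition bop_pos T := forall x : H, 0 <= inner (T x) x.

Definition bop_le S T := bop_pos (T - S).

Definition bop_inverse T S := S * T = 1 /\ T * S = 1.

Definition bop_inv T : bop H := xget 0 [set S | bop_inverse T S].

Definition spectrum T : set C :=
  [set z : C | ~ exists S : bop H, bop_inverse (T - z *: (1 : bop H)) S].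

Definition bop_horner (p : {poly R}) T : bop H :=
  \sum_(i < size p) (p`_i)%:C *: T ^+ i.

(* Continuous functional calculus for a self-adjoint T, whose spectrum is
   real: f(T) is the limit in operator norm of p_n(T) whenever the
   polynomials p_n converge to f uniformly on the spectrum of T. *)
Definition is_fun_calc (f : R -> R) T S := exists p : nat -> {poly R},
  (forall e : R, 0 < e -> \forall n \near \oo,
     forall x : R, spectrum T x%:C -> `|(p n).[x] - f x| <= e) /\
  (forall e : R, 0 < e -> \forall n \near \oo,
     forall x : H, `|bop_horner (p n) T x - S x| <= e%:C * `|x|).

(* Meaningful for strictly positive T, whose spectrum lies in ]0, +oo[. *)
Definition bop_pow T (r : R) : bop H :=
  xget 0 [set S | is_fun_calc (fun x => x `^ r) T S].

Definition geometric_mean S T : bop H :=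
  bop_pow S 2^-1 *
  bop_pow (bop_pow S (- 2^-1) * T * bop_pow S (- 2^-1)) 2^-1 *
  bop_pow S 2^-1.

Definition positive_map (Phi : bop H -> bop H) :=
  forall T, bop_pos T -> bop_pos (Phi T).

Definition normalized_map (Phi : bop H -> bop H) := Phi 1 = 1.

End Positivity.

Definition bop_scalar {R : realType} (H : hilbertType R) (c : R) : bop H :=
  c%:C *: (1 : bop H).
Arguments bop_scalar {R} H c.

Notation "S <=op T" := (bop_le S T) (at level 70, no associativity).
Notation "S ^op r" := (bop_pow S r) (at level 30, right associativity).
Notation "S '#op' T" := (geometric_mean S T) (at level 40, left associativity).

(* Main.v *)
(* The first bound is Phi applied to A + Mm A^-1 <= M + m, which holds since
   (M - t)(t - m) >= 0 on the spectrum of A.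

   The second one is the operator concavity of t^r. If T > 0, the form
   <T^r x, x> + 2 Re <T^((r+s)/2) x, y> + <T^s y, y> is positive, and conversely
   if <T^r x, x> + 2 Re <Z x, y> + <T^s y, y> is positive then
   Z <= T^((r+s)/2). Summing such forms shows that the exponents for which t^r is
   concave form a midpoint-convex set; it is closed and contains 0 and 1, hence
   [0, 1]. Approximability of t^r by polynomials is obtained in the same way,
   starting from the exponents -1 and 1.

   For the third one, the geometric mean is U V U with U^2 = P and U V^2 U = Q, so
   that |U x - s V U x|^2 >= 0 gives 2 U V U <= P / s + s Q for all s > 0. Its
   inverse is the geometric mean of the inverses and inversion is antitone, which
   yields the case of negative exponents. *)

Require Import Defs.
From HB Require Import structures.
From mathcomp Require Import all_boot all_order all_algebra.
From mathcomp Require Import sesquilinear complex.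
From mathcomp Require Import all_classical all_reals all_analysis.
From mathcomp Require Import ring lra.
Import Order.TTheory GRing.Theory Num.Theory.
Import numFieldNormedType.Exports.

Set Implicit Arguments.
Unset Strict Implicit.
Unset Printing Implicit Defensive.
Local Open Scope classical_set_scope.
Local Open Scope complex_scope.
Local Open Scope ring_scope.

Section RealInnerProduct.
Context {R : realType} {H : hilbertType R}.
Local Notation C := R[i].
Implicit Types (x y z : H) (a b c : R) (S T : bop H).

(* A complex-linear operator is self-adjoint as soon as it is so for this real
   inner product. *)
Definition ip x y : R := complex.Re (inner x y).
Definition nm x : R := complex.Re `|x|.

Lemma innerC x y : inner x y = conjc (inner y x).
Proof. by have := hermC inner x y; rewrite /= expr0 mul1r. Qed.

Lemma ReD (u v : C) : complex.Re (u + v) = complex.Re u + complex.Re v.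
Proof. by case: u v => [? ?] [? ?]. Qed.

Lemma ReN (u : C) : complex.Re (- u) = - complex.Re u.
Proof. by case: u => [? ?]. Qed.

Lemma ReZ a (u : C) : complex.Re (a%:C * u) = a * complex.Re u.
Proof. by case: u => [? ?] /=; rewrite mul0r subr0. Qed.

Lemma ipC x y : ip x y = ip y x.
Proof. by rewrite /ip innerC; case: (inner y x). Qed.

Lemma ipDl x y z : ip (x + y) z = ip x z + ip y z.
Proof. by rewrite /ip linearDl ReD. Qed.

Lemma ipDr x y z : ip z (x + y) = ip z x + ip z y.
Proof. by rewrite ipC ipDl !(ipC z). Qed.

Lemma ipNl x y : ip (- x) y = - ip x y.
Proof. by rewrite /ip linearNl ReN. Qed.

Lemma ipNr x y : ip y (- x) = - ip y x.
Proof. by rewrite ipC ipNl ipC. Qed.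

Lemma ipZl a x y : ip (a%:C *: x) y = a * ip x y.
Proof. by rewrite /ip linearZl_LR ReZ. Qed.

Lemma ipZr a x y : ip y (a%:C *: x) = a * ip y x.
Proof. by rewrite ipC ipZl ipC. Qed.

Lemma ip0l x : ip 0 x = 0.
Proof. by rewrite -(scale0r x) (ipZl 0) mul0r. Qed.

Lemma ip0r x : ip x 0 = 0.
Proof. by rewrite ipC ip0l. Qed.

Definition ipE := (ipDl, ipDr, ipNl, ipNr, ipZl, ipZr).

Lemma normE x : `|x| = (nm x)%:C.
Proof.
by rewrite /nm; have := normr_ge0 x; case: `|x| => u v /ger0_Im /= ->.
Qed.

Lemma nm_ge0 x : 0 <= nm x.
Proof. by have := normr_ge0 x; rewrite normE ler0c. Qed.

Lemma ipxx x : ip x x = nm x ^+ 2.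
Proof. by rewrite /ip inner_norm normE -rmorphXn. Qed.

Lemma ipxx_ge0 x : 0 <= ip x x.
Proof. by rewrite ipxx sqr_ge0. Qed.

Lemma nm_eq0 x : nm x = 0 -> x = 0.
Proof. by move=> x0; apply/normr0_eq0; rewrite normE x0. Qed.

Lemma nm0 : nm 0 = 0.
Proof. by rewrite /nm normr0. Qed.

Lemma ipxx_eq0 x : ip x x = 0 -> x = 0.
Proof. by rewrite ipxx => /eqP; rewrite sqrf_eq0 => /eqP /nm_eq0. Qed.

Lemma ip_eq0 x : (forall y, ip x y = 0) -> x = 0.
Proof. by move=> /(_ x) /ipxx_eq0. Qed.

Lemma nm_leP x c : 0 <= c -> (nm x <= c) = (ip x x <= c ^+ 2).
Proof. by move=> c0; rewrite ipxx ler_pXn2r ?nnegrE ?nm_ge0. Qed.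

Lemma nm_triangle x y z : nm (x - z) <= nm (x - y) + nm (y - z).
Proof.
rewrite -lecR -[X in X <= _]normE rmorphD /= -!normE.
by rewrite (_ : x - z = (x - y) + (y - z)) ?ler_normD// addrA subrK.
Qed.

Lemma nmB x y : nm (x - y) = nm (y - x).
Proof. by rewrite /nm distrC. Qed.

Lemma bopDr T x y : T (x + y) = T x + T y.
Proof. by have := bop_is_linear T 1 x y; rewrite !scale1r. Qed.

Lemma bop0r T : T 0 = 0.
Proof. by apply: (addrI (T 0)); rewrite -bopDr !addr0. Qed.

Lemma bopZr T (k : C) x : T (k *: x) = k *: T x.
Proof. by have := bop_is_linear T k x 0; rewrite bop0r !addr0. Qed.

Lemma bopNr T x : T (- x) = - T x.
Proof. by rewrite -scaleN1r bopZr scaleN1r. Qed.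

Lemma bopDE S T x : (S + T) x = S x + T x. Proof. by []. Qed.
Lemma bopNE S x : (- S) x = - S x. Proof. by []. Qed.
Lemma bopZE (k : C) S x : (k *: S) x = k *: S x. Proof. by []. Qed.
Lemma bopME S T x : (S * T) x = S (T x). Proof. by []. Qed.
Lemma bop1E x : (1 : bop H) x = x. Proof. by []. Qed.
Lemma bop0E x : (0 : bop H) x = 0. Proof. by []. Qed.
Lemma bop_scalarE c x : bop_scalar H c x = c%:C *: x. Proof. by []. Qed.

Definition bopE :=
  (bopDE, bopNE, bopZE, bopME, bop1E, bop0E, bop_scalarE, bopDr, bopNr, bopZr).

Lemma bopZMl (k : C) S T : (k *: S) * T = k *: (S * T).
Proof. by apply: bopP => x. Qed.

Lemma bopZMr (k : C) S T : S * (k *: T) = k *: (S * T).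
Proof. by apply: bopP => x; rewrite !bopE. Qed.

Lemma bop_bnd T : exists2 K : R, 0 < K & forall x, nm (T x) <= K * nm x.
Proof.
have [K TK] := bop_bounded T; exists (`|complex.Re K| + 1) => [|x].
  by rewrite ltr_wpDl.
have := TK x; rewrite !normE mulrC lecE => /andP[_]; rewrite ReZ /=.
move=> /le_trans; apply.
rewrite mulrC ler_wpM2r ?nm_ge0// (le_trans (ler_norm _))//.
by rewrite lerDl.
Qed.

Definition sa T := forall x y, ip (T x) y = ip x (T y).

Definition psd T := forall x, 0 <= ip (T x) x.

Lemma bop_pos_sa T : bop_pos T -> sa T.
Proof.
move=> Tpos.
have Im0 x : complex.Im (inner (T x) x) = 0 by apply/ger0_Im/Tpos.
have ImD (u v : C) : complex.Im (u + v) = complex.Im u + complex.Im v.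
  by case: u v => [? ?] [? ?].
have E x y : complex.Im (inner (T x) y) = complex.Im (inner x (T y)).
  have := Im0 (x + y).
  rewrite bopDr linearDl !linearDr !ImD !Im0 add0r addr0 [inner x _]innerC.
  have -> (u : C) : complex.Im u^*%C = - complex.Im u by case: u.
  by move=> /eqP; rewrite addr_eq0 => /eqP.
move=> x y; have := E ('i *: x) y.
rewrite bopZr !linearZl_LR /= !(mulrC 'i) !ImiRe; exact.
Qed.

Lemma bop_posP T : bop_pos T <-> sa T /\ psd T.
Proof.
split=> [Tpos|[Tsa Tpsd] x].
  split; first exact: bop_pos_sa.
  by move=> x; have := Tpos x; rewrite lecE => /andP[].
rewrite lecE [X in _ && X]Tpsd andbT; apply/eqP.
have := Tsa ('i *: x) x; rewrite bopZr /ip !linearZl_LR /= !(mulrC 'i) !ReiNIm.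
rewrite [inner x _]innerC; case: (inner _ _) => u v /= /eqP.
by rewrite opprK eq_sym -addr_eq0 -mulr2n mulrn_eq0 /= => /eqP.
Qed.

Lemma sa1 : sa 1. Proof. by []. Qed.

Lemma saD S T : sa S -> sa T -> sa (S + T).
Proof. by move=> s t x y; rewrite !bopE !ipE s t. Qed.

Lemma saN S : sa S -> sa (- S).
Proof. by move=> s x y; rewrite !bopE !ipE s. Qed.

Lemma saB S T : sa S -> sa T -> sa (S - T).
Proof. by move=> s t; apply: saD => //; apply: saN. Qed.

Lemma saZ c S : sa S -> sa (c%:C *: S).
Proof. by move=> s x y; rewrite !bopE !ipE s. Qed.

Lemma sa_scalar c : sa (bop_scalar H c).
Proof. exact: saZ sa1. Qed.

Lemma saM S T : sa S -> sa T -> S * T = T * S -> sa (S * T).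
Proof. by move=> s t ST x y; rewrite {1}ST !bopE t s. Qed.

Lemma saMM S T : sa S -> sa T -> sa (S * T * S).
Proof. by move=> s t x y; rewrite !bopE s t s. Qed.

Lemma bop_leP S T : sa S -> sa T ->
  S <=op T <-> forall x, ip (S x) x <= ip (T x) x.
Proof.
move=> s t; rewrite /bop_le bop_posP; split=> [[_ h] x|h].
  by have := h x; rewrite !bopE !ipE subr_ge0.
by split=> [|x]; [exact: saB | rewrite !bopE !ipE subr_ge0].
Qed.

Lemma quadratic_discriminant a b c :
  (forall s t : R, 0 <= s ^+ 2 * a + 2 * (s * t * b) + t ^+ 2 * c) ->
  b ^+ 2 <= a * c.
Proof.
move=> h; have a0 : 0 <= a by have := h 1 0; lra.
have c0 : 0 <= c by have := h 0 1; lra.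
have [c00|c_neq0] := eqVneq c 0.
  have := h b (- (a + 1)); rewrite c00; nra.
have cpos : 0 < c by rewrite lt_neqAle eq_sym c_neq0.
rewrite -subr_ge0 -(pmulr_rge0 _ cpos); have := h c (- b).
by congr (0 <= _); ring.
Qed.

Lemma cauchy_schwarz T x y : sa T -> psd T ->
  ip (T x) y ^+ 2 <= ip (T x) x * ip (T y) y.
Proof.
move=> Tsa Tpsd; apply: quadratic_discriminant => s t.
have := Tpsd (s%:C *: x + t%:C *: y).
rewrite !bopE !ipE (Tsa y x) (ipC y).
by congr (0 <= _); ring.
Qed.

Lemma ip_le_nm x y : `|ip x y| <= nm x * nm y.
Proof.
rewrite -ler_sqr ?nnegrE ?mulr_ge0 ?nm_ge0// real_normK ?num_real//.
by rewrite exprMn -!ipxx; apply: (cauchy_schwarz _ _ sa1) => z; exact: ipxx_ge0.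
Qed.

(* Cauchy-Schwarz for the form of T, at the vectors x and T x. *)
Lemma psd_nm_le T K x : sa T -> psd T ->
    (forall x, ip (T x) x <= K * ip x x) ->
  ip (T x) (T x) <= K * ip (T x) x.
Proof.
move=> Tsa Tpsd TK; have := cauchy_schwarz x (T x) Tsa Tpsd.
have := TK (T x); have := ipxx_ge0 (T x); have := Tpsd x.
set u := ip (T x) (T x); move=> q0; rewrite le_eqVlt => /predU1P[<-|u0] h1 h2.
  have [K0|K0] := leP 0 K; first exact: mulr_ge0.
  have := TK x; have := ipxx_ge0 x; nra.
rewrite -(ler_pM2l u0) -expr2 (le_trans h2)//; nra.
Qed.

Lemma quad_bounded T : exists2 K : R, 0 < K &
  forall x, `|ip (T x) x| <= K * ip x x.
Proof.
have [K K0 TK] := bop_bnd T; exists K => // x.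
rewrite (le_trans (ip_le_nm _ _))// ipxx expr2 mulrA.
by rewrite ler_wpM2r ?nm_ge0.
Qed.

End RealInnerProduct.
Arguments ipE {R H}.
Arguments bopE {R H}.

Section Completeness.
Context {R : realType} {H : hilbertType R}.
Local Notation C := R[i].
Implicit Types (x y z : H) (a b c : R) (S T : bop H).

Lemma nm_cauchy_cvg (u : nat -> H) :
  (forall e, 0 < e -> exists N, forall m n, (N <= m)%N -> (N <= n)%N ->
     nm (u m - u n) <= e) ->
  cvg (u n @[n --> \oo]).
Proof.
move=> uC; apply: cauchy_cvg; apply: cauchy_exP => e e0.
have [a -> a0] : exists2 a : R, e = a%:C & 0 < a.
  by case: e e0 => s t; rewrite ltcE /= => /andP[/eqP-> s0]; exists s.
have [N uN] := uC _ (divr_gt0 a0 (ltr0Sn R 1)); exists (u N).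
exists N => // n /= Nn; rewrite -ball_normE /ball_ /= normE ltcR.
by rewrite (le_lt_trans (uN _ _ _ Nn))//; lra.
Qed.

Lemma cvg_nmP (u : nat -> H) (l : H) : u n @[n --> \oo] --> l ->
  forall e, 0 < e -> exists N, forall n, (N <= n)%N -> nm (u n - l) <= e.
Proof.
move=> /cvgrPdist_le ul e e0; have := ul e%:C; rewrite ltcR => /(_ e0)[N _ uN].
by exists N => n /uN /=; rewrite normE lecR nmB.
Qed.

Lemma bop_complete (S_ : nat -> bop H) :
  (forall e, 0 < e -> exists N, forall m n, (N <= m)%N -> (N <= n)%N ->
     forall x, nm (S_ m x - S_ n x) <= e * nm x) ->
  exists S, forall e, 0 < e -> exists N, forall n, (N <= n)%N ->
     forall x, nm (S_ n x - S x) <= e * nm x.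
Proof.
move=> SC.
have cv x : cvg (S_ n x @[n --> \oo]).
  apply: nm_cauchy_cvg => e e0.
  have x1 : 0 < nm x + 1 by rewrite ltr_wpDl ?nm_ge0.
  have [N SN] := SC _ (divr_gt0 e0 x1); exists N => m n Nm Nn.
  rewrite (le_trans (SN _ _ Nm Nn x))// mulrAC ler_pdivrMr//.
  by rewrite ler_pM2l// lerDl.
pose f x : H := lim (S_ n x @[n --> \oo]).
have unif e : 0 < e -> exists N, forall n, (N <= n)%N ->
    forall x, nm (S_ n x - f x) <= e * nm x.
  move=> e0; have [N SN] := SC _ e0; exists N => n Nn x.
  apply/ler_addgt0Pr => d d0; have [M SM] := cvg_nmP (cv x) d0.
  rewrite (le_trans (nm_triangle _ (S_ (maxn M N) x) _))// lerD//.
    by apply: SN; rewrite // leq_maxr.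
  by apply: SM; rewrite leq_maxl.
have fP : f \in is_bop.
  apply/is_bopP; split=> [a x y|].
    apply: (@cvg_unique _ (@norm_hausdorff _ H)
                        (S_ n (a *: x + y) @[n --> \oo])).
      exact: cv.
    rewrite (_ : (fun n => _) = (fun n => a *: S_ n x + S_ n y)); last first.
      by apply/funext => n; rewrite bop_is_linear.
    by apply: cvgD; [apply: cvgZr; exact: cv | exact: cv].
  have [N SN] := unif _ ltr01; have [K K0 SK] := bop_bnd (S_ N).
  exists (1 + K)%:C => x; rewrite !normE -rmorphM lecR /=.
  have := nm_triangle (f x) (S_ N x) 0; rewrite !subr0 => /le_trans; apply.
  by rewrite mulrDl lerD// nmB SN.
by exists (Bop fP).
Qed.

End Completeness.

Section Invertibility.
Context {R : realType} {H : hilbertType R}.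
Local Notation C := R[i].
Implicit Types (x y z : H) (a b c : R) (S T : bop H).

Definition lower_bound T a := forall x, a * ip x x <= ip (T x) x.
Definition upper_bound T a := forall x, ip (T x) x <= a * ip x x.

Definition spd T := sa T /\ exists2 d : R, 0 < d & lower_bound T d.

Lemma lower_bound_nm T a x : 0 <= a -> lower_bound T a ->
  a * nm x <= nm (T x).
Proof.
move=> a0 Ta; have [x0|x0] := eqVneq (nm x) 0; first by rewrite x0 mulr0 nm_ge0.
have xpos : 0 < nm x by rewrite lt_neqAle eq_sym x0 nm_ge0.
rewrite -(ler_pM2r xpos) -mulrA -expr2 -ipxx (le_trans (Ta x))//.
by rewrite (le_trans (ler_norm _))// ip_le_nm.
Qed.

Lemma bop_inverseM S T S' T' : bop_inverse S S' -> bop_inverse T T' ->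
  bop_inverse (S * T) (T' * S').
Proof.
move=> [s1 s2] [t1 t2]; split.
  by rewrite mulrA -(mulrA T') s1 mulr1 t1.
by rewrite mulrA -(mulrA S) t2 mulr1 s2.
Qed.

Lemma bop_inverse_sym S T : bop_inverse S T -> bop_inverse T S.
Proof. by case. Qed.

Lemma bop_inverse_uniq T S S' : bop_inverse T S -> bop_inverse T S' -> S = S'.
Proof. by move=> [s1 _] [_ t2]; rewrite -(mulr1 S) -t2 mulrA s1 mul1r. Qed.

Lemma bop_invE T S : bop_inverse T S -> bop_inv T = S.
Proof.
move=> TS; apply: (bop_inverse_uniq _ TS); apply: (@xgetPex _ 0).
by exists S.
Qed.

Lemma sa_inverse T S : bop_inverse T S -> sa T -> sa S.
Proof.
move=> [ST TS] Tsa x y.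
by rewrite -{2}[x]bop1E -{1}[y]bop1E -TS !bopME Tsa.
Qed.

Lemma nm_contraction T r x : sa T -> psd T -> upper_bound T r -> 0 <= r ->
  nm (T x) <= r * nm x.
Proof.
move=> Tsa T0 Tr r0; rewrite nm_leP ?mulr_ge0 ?nm_ge0// exprMn -ipxx.
rewrite (le_trans (psd_nm_le x Tsa T0 Tr))// expr2 -mulrA.
by rewrite ler_wpM2l.
Qed.

Lemma expr_lt_eps (r e : R) : 0 <= r -> r < 1 -> 0 < e ->
  exists N, forall n, (N <= n)%N -> r ^+ n <= e.
Proof.
move=> r0 r1 e0; have /cvg_expr : `|r| < 1 by rewrite ger0_norm.
move=> /cvgr0Pnorm_le /(_ _ e0)[N _ h]; exists N => n /h.
by rewrite /= ger0_norm// exprn_ge0.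
Qed.

(* Neumann series for T^-1 = K^-1 (1 - D)^-1 with D = 1 - K^-1 T; that T is
   bounded below makes the partial sums a Cauchy sequence. *)
Lemma spd_invertible T : spd T -> exists S, bop_inverse T S.
Proof.
move=> [Tsa [d d0 Td]].
have [K1 K10 TK1] := quad_bounded T.
pose K := K1 + d; have K0 : 0 < K by rewrite addr_gt0.
pose D : bop H := 1 - (K^-1)%:C *: T.
have TD : T = K%:C *: (1 - D).
  by rewrite /D opprB addrC subrK scalerA -rmorphM /= divff ?gt_eqF// scale1r.
pose r := 1 - d / K.
have r0 : 0 <= r by rewrite subr_ge0 ler_pdivrMr// mul1r lerDr ltW.
have r1 : r < 1 by rewrite ltrBlDr ltrDl divr_gt0.
have Dsa : sa D by apply: saB; [exact: sa1 | exact: saZ].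
have D0 : psd D.
  move=> x; rewrite !bopE !ipE subr_ge0 ler_pdivrMl//.
  rewrite (le_trans (ler_norm _))// (le_trans (TK1 x))//.
  by rewrite ler_wpM2r ?ipxx_ge0// lerDl ltW.
have Dr : upper_bound D r.
  move=> x; rewrite !bopE !ipE /r mulrBl mul1r lerD2l lerN2 mulrAC.
  by rewrite (mulrC K^-1) ler_pM2r ?invr_gt0// Td.
have Dn n x : nm ((D ^+ n) x) <= r ^+ n * nm x.
  elim: n => [|n IH]; first by rewrite !expr0 mul1r.
  rewrite !exprS bopME (le_trans (nm_contraction _ Dsa D0 Dr r0))//.
  by rewrite -mulrA ler_wpM2l.
pose Z n : bop H := (K^-1)%:C *: \sum_(i < n) D ^+ i.
have TZ n : T * Z n = 1 - D ^+ n.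
  rewrite /Z bopZMr TD bopZMl scalerA -rmorphM mulVf ?gt_eqF// scale1r.
  by rewrite -(opprB D 1) mulNr -subrX1 (opprB (D ^+ n)).
have Tlow x : d * nm x <= nm (T x) by apply: lower_bound_nm => //; exact: ltW.
have [e e0|S SZ] := @bop_complete R H Z.
  have ed0 : 0 < e * d / 2 by rewrite divr_gt0// mulr_gt0.
  have [N DN] := expr_lt_eps r0 r1 ed0; exists N => m n Nm Nn x.
  rewrite -(ler_pM2l d0) (le_trans (Tlow _))//.
  have -> : T (Z m x - Z n x) = (D ^+ n) x - (D ^+ m) x.
    rewrite bopDr bopNr -!bopME !TZ !bopE opprD opprK addrACA subrr add0r.
    by rewrite addrC.
  rewrite (le_trans (nm_triangle _ 0 _))// subr0 sub0r.
  rewrite (_ : nm (- _) = nm ((D ^+ m) x)); last first.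
    by rewrite -[- _]sub0r nmB subr0.
  have := ler_wpM2r (nm_ge0 x) (DN m Nm).
  have := ler_wpM2r (nm_ge0 x) (DN n Nn).
  have := Dn m x; have := Dn n x; lra.
have TS : T * S = 1.
  apply: bopP => x; apply/eqP; rewrite -subr_eq0; apply/eqP/nm_eq0/eqP.
  rewrite eq_le nm_ge0 andbT; apply/ler_addgt0Pr => e e0; rewrite add0r.
  have [B B0 TB] := bop_bnd T.
  pose w := nm x + 1; have w0 : 0 < w by rewrite ltr_wpDl ?nm_ge0.
  have xw : nm x <= w by rewrite lerDl.
  pose e1 := e / 2 / w; have e10 : 0 < e1 by rewrite !divr_gt0.
  have [N1 SN] := SZ _ (divr_gt0 e10 B0).
  have [N2 DN] := expr_lt_eps r0 r1 e10.
  pose n := maxn N1 N2.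
  rewrite (le_trans (nm_triangle _ (T (Z n x)) _))//.
  have -> : e = e1 * w + e1 * w by rewrite /e1 divfK ?gt_eqF//; lra.
  rewrite lerD//.
    have -> : (T * S) x - T (Z n x) = T (S x - Z n x) by rewrite !bopE.
    rewrite (le_trans (TB _))// nmB -ler_pdivlMl//.
    rewrite (le_trans (SN _ (leq_maxl _ _) _))// mulrCA mulrA.
    by rewrite ler_wpM2l// ltW// mulr_gt0// invr_gt0.
  rewrite -bopME TZ !bopE addrAC subrr sub0r -[- _]sub0r nmB subr0.
  rewrite (le_trans (Dn _ _))// ler_pM// ?nm_ge0 ?exprn_ge0//.
  by apply: DN; rewrite leq_maxr.
exists S; split=> //; apply: bopP => x.
apply/eqP; rewrite -subr_eq0; apply/eqP/nm_eq0/eqP.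
rewrite eq_le nm_ge0 andbT -(ler_pM2l d0) mulr0 (le_trans (Tlow _))//.
rewrite (_ : T _ = 0) ?nm0//.
by rewrite bopDr bopNr -!bopME mulrA TS mul1r mulr1 subrr.
Qed.

End Invertibility.

Section Spectrum.
Context {R : realType} {H : hilbertType R}.
Local Notation C := R[i].
Implicit Types (x y z : H) (a b c : R) (S T : bop H) (p q : {poly R}).

Lemma psd_inverse_spd T S : sa T -> psd T -> bop_inverse T S -> spd T.
Proof.
move=> Tsa T0 [ST _]; split=> //.
have [B B0 SB] := bop_bnd S; have [K K0 TK] := quad_bounded T.
exists (B ^+ 2 * K)^-1 => [|x]; first by rewrite invr_gt0 mulr_gt0 ?exprn_gt0.
have TuK : upper_bound T K.
  by move=> y; rewrite (le_trans (ler_norm _))// TK.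
rewrite ler_pdivrMl ?mulr_gt0 ?exprn_gt0//.
have -> : ip x x = nm (S (T x)) ^+ 2 by rewrite ipxx -bopME ST.
rewrite -mulrA (@le_trans _ _ (B ^+ 2 * ip (T x) (T x)))//.
  by rewrite ipxx -exprMn ler_pXn2r ?nnegrE ?mulr_ge0 ?nm_ge0// ltW.
by rewrite ler_pM2l ?exprn_gt0//; apply: psd_nm_le.
Qed.

Lemma spectrum_lt T a x0 : sa T -> ip (T x0) x0 < a * ip x0 x0 ->
  exists2 b, b < a & spectrum T b%:C.
Proof.
move=> Tsa x0a; have [K K0 TK] := quad_bounded T.
have x00 : 0 < ip x0 x0.
  rewrite lt_neqAle ipxx_ge0 andbT; apply/eqP => /esym/ipxx_eq0 h.
  by move: x0a; rewrite h ip0r ip0r mulr0 ltxx.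
pose E : set R := lower_bound T.
have E0 : E (- K).
  by move=> x; have := TK x; rewrite ler_norml mulNr => /andP[].
have Eub b : E b -> b <= ip (T x0) x0 / ip x0 x0.
  by move=> /(_ x0); rewrite ler_pdivlMr.
have hsE : has_sup E.
  by split; [exists (- K) | exists (ip (T x0) x0 / ip x0 x0)].
pose m := sup E.
have ma : m < a.
  rewrite (@le_lt_trans _ _ (ip (T x0) x0 / ip x0 x0)) ?ltr_pdivrMr//.
  by apply: ge_sup; [exists (- K) | move=> b /Eub].
have Em : E m.
  move=> x; have [x00'|xpos] := eqVneq (ip x x) 0.
    by have := TK x; rewrite x00' !mulr0 normr_le0 => /eqP->.
  have {}xpos : 0 < ip x x by rewrite lt_neqAle eq_sym xpos ipxx_ge0.
  rewrite -ler_pdivlMr//; apply: ge_sup; first by exists (- K).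
  by move=> b /(_ x); rewrite ler_pdivlMr.
exists m => // -[S TS].
have [|x|_ [d d0 Td]] := psd_inverse_spd _ _ TS.
- exact/saB/(sa_scalar m).
- by rewrite !bopE !ipE subr_ge0.
have : E (m + d).
  by move=> x; have := Td x; rewrite !bopE !ipE lerBrDl mulrDl.
move=> /(ub_le_sup (proj2 hsE)); rewrite -/m; lra.
Qed.

Lemma mulrBD_comm (A B : bop H) : A * B = B * A ->
  (A - B) * (A + B) = A * A - B * B.
Proof. by move=> AB; rewrite mulrBl !mulrDr AB opprD addrA addrK. Qed.

Lemma mulrDB_comm (A B : bop H) : A * B = B * A ->
  (A + B) * (A - B) = A * A - B * B.
Proof. by move=> AB; rewrite mulrDl !mulrBr AB addrA subrK. Qed.

Lemma spectrum_real T (w : C) : sa T -> spectrum T w -> w = (complex.Re w)%:C.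
Proof.
case: w => a b Tsa /= ninv; have [->//|b0] := eqVneq b 0.
exfalso; apply: ninv.
pose A : bop H := T - a%:C *: (1 : bop H).
have Asa : sa A by exact/saB/(sa_scalar a).
pose I : bop H := (0 +i* b) *: (1 : bop H).
have IA S : S * I = I * S by rewrite /I bopZMr bopZMl mulr1 mul1r.
have E1 : T - (a +i* b) *: (1 : bop H) = A - I.
  rewrite /A /I -addrA -opprD -scalerDl; congr (_ - _ *: _).
  by apply/eqP; rewrite eq_complex /= addr0 add0r !eqxx.
have E2 : (A - I) * (A + I) = A * A + (b ^+ 2)%:C *: (1 : bop H).
  rewrite mulrBD_comm ?IA// /I bopZMl mul1r scalerA -scaleNr.
  congr (_ + _ *: _); apply/eqP; rewrite eq_complex /=.
  by rewrite !mul0r !mulr0 sub0r opprK addr0 oppr0 !eqxx.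
clearbody A I.
have [|S [S1 S2]] := @spd_invertible _ _ (A * A + (b ^+ 2)%:C *: (1 : bop H)).
  split; first by apply: saD; [exact: saM | exact: (sa_scalar (b ^+ 2))].
  exists (b ^+ 2) => [|x].
    by rewrite lt_neqAle eq_sym sqrf_eq0 b0 sqr_ge0.
  by rewrite !bopE !ipE Asa lerDr ipxx_ge0.
have cAI : (A - I) * (A + I) = (A + I) * (A - I).
  by rewrite mulrBD_comm ?IA// mulrDB_comm ?IA.
rewrite E1; exists ((A + I) * S).
have l1 : S * (A + I) * (A - I) = 1 by rewrite -mulrA -cAI E2.
have r1 : (A - I) * ((A + I) * S) = 1 by rewrite mulrA E2.
split=> //; rewrite -[RHS]l1; congr (_ * _).
by rewrite -[RHS]mulr1 -[X in _ = _ * X]r1 [RHS]mulrA l1 mul1r.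
Qed.

Definition chorner (p : {poly C}) T : bop H :=
  \sum_(i < size p) p`_i *: T ^+ i.

Lemma chornerE (p : {poly C}) T n : (size p <= n)%N ->
  chorner p T = \sum_(i < n) p`_i *: T ^+ i.
Proof.
move=> pn; rewrite /chorner (big_ord_widen n (fun i => p`_i *: T ^+ i))//.
rewrite big_mkcond /=; apply: eq_bigr => i _.
by case: ltnP => // /leq_sizeP/(_ _ (leqnn _)) ->; rewrite scale0r.
Qed.

Lemma chornerD (p q : {poly C}) T :
  chorner (p + q) T = chorner p T + chorner q T.
Proof.
pose n := maxn (size p) (size q).
rewrite !(@chornerE _ _ n) ?leq_maxl ?leq_maxr ?size_polyD// -big_split /=.
by apply: eq_bigr => i _; rewrite coefD scalerDl.
Qed.

Lemma chornerZ (k : C) (p : {poly C}) T : chorner (k *: p) T = k *: chorner p T.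
Proof.
rewrite (@chornerE _ _ (size p)) ?size_scale_leq// scaler_sumr.
by apply: eq_bigr => i _; rewrite coefZ scalerA.
Qed.

Lemma chornerC (k : C) T : chorner k%:P T = k *: (1 : bop H).
Proof.
by rewrite (@chornerE _ _ 1) ?size_polyC_leq1// big_ord1 coefC /= expr0.
Qed.

Lemma chornerMX (p : {poly C}) T : chorner (p * 'X) T = chorner p T * T.
Proof.
rewrite (@chornerE _ _ (size p).+1); last first.
  by rewrite (leq_trans (size_polyMleq _ _))// size_polyX addn2.
rewrite big_ord_recl coefMX /= scale0r add0r /chorner mulr_suml.
by apply: eq_bigr => i _; rewrite coefMX /= bopZMl exprSr.
Qed.

Lemma chornerM (p q : {poly C}) T :
  chorner (p * q) T = chorner p T * chorner q T.
Proof.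
elim/poly_ind: q => [|q c IH].
  by rewrite mulr0 -[0 : {poly C}]polyC0 chornerC scale0r mulr0.
rewrite mulrDr mulrA chornerD chornerMX IH chornerD chornerMX chornerC.
by rewrite mulrC mul_polyC chornerZ mulrDr mulrA bopZMr mulr1.
Qed.

Lemma chorner_prod_invertible T (rs : seq C) :
  (forall w, w \in rs -> exists S, bop_inverse (T - w *: (1 : bop H)) S) ->
  exists S, bop_inverse (chorner (\prod_(w <- rs) ('X - w%:P)) T) S.
Proof.
elim: rs => [|w rs IH] inv.
  by rewrite big_nil -polyC1 chornerC scale1r; exists 1; split; rewrite mulr1.
rewrite big_cons chornerM.
have -> : chorner ('X - w%:P) T = T - w *: (1 : bop H).
  rewrite -polyCN chornerD chornerC -['X]mul1r chornerMX -polyC1 chornerC.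
  by rewrite scale1r mul1r scaleNr.
have [|S1 h1] := inv w; first by rewrite mem_head.
have [u urs|S2 h2] := IH; first by apply: inv; rewrite in_cons urs orbT.
by exists (S2 * S1); apply: bop_inverseM.
Qed.

Lemma bop_hornerE p T :
  bop_horner p T = chorner (map_poly (real_complex R) p) T.
Proof.
by rewrite /chorner size_map_poly; apply: eq_bigr => i _; rewrite coef_map.
Qed.

Lemma bop_hornerD p q T :
  bop_horner (p + q) T = bop_horner p T + bop_horner q T.
Proof. by rewrite !bop_hornerE rmorphD chornerD. Qed.

Lemma bop_hornerC c T : bop_horner c%:P T = bop_scalar H c.
Proof. by rewrite bop_hornerE map_polyC chornerC. Qed.

Lemma bop_hornerM p q T :
  bop_horner (p * q) T = bop_horner p T * bop_horner q T.
Proof. by rewrite !bop_hornerE rmorphM chornerM. Qed.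

Lemma bop_hornerZ c p T : bop_horner (c *: p) T = c%:C *: bop_horner p T.
Proof. by rewrite -mul_polyC bop_hornerM bop_hornerC bopZMl mul1r. Qed.

Lemma bop_hornerN p T : bop_horner (- p) T = - bop_horner p T.
Proof. by rewrite -scaleN1r bop_hornerZ rmorphN scaleN1r. Qed.

Lemma bop_hornerX T : bop_horner 'X T = T.
Proof.
rewrite bop_hornerE map_polyX -['X]mul1r chornerMX -polyC1 chornerC.
by rewrite scale1r mul1r.
Qed.

Lemma sa_horner p T : sa T -> sa (bop_horner p T).
Proof.
move=> Tsa; elim/poly_ind: p => [|p c IH].
  by rewrite -polyC0 bop_hornerC; exact: sa_scalar.
rewrite bop_hornerD bop_hornerM bop_hornerC bop_hornerX.
apply: saD; last exact: sa_scalar.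
apply: saM => //; have : bop_horner (p * 'X) T = bop_horner ('X * p) T.
  by rewrite mulrC.
by rewrite !bop_hornerM bop_hornerX.
Qed.

(* A negative infimum b of the form of p(T) lies in the spectrum of p(T);
   factoring p - b over R[i] makes some root of p - b a point of the spectrum
   of T. *)
Lemma bop_horner_psd p T : sa T ->
  (forall t, spectrum T t%:C -> 0 <= p.[t]) -> psd (bop_horner p T).
Proof.
move=> Tsa p0; apply: contrapT => /existsNP[x /negP]; rewrite -ltNge => xneg.
have x0 : 0 < ip x x.
  rewrite lt_neqAle ipxx_ge0 andbT; apply/eqP => /esym/ipxx_eq0 h.
  by move: xneg; rewrite h ip0r ltxx.
have [|b b0 nb] := @spectrum_lt (bop_horner p T) 0 x (sa_horner p Tsa).
  by rewrite mul0r.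
have [|t0 _ /p0 pt0] := @spectrum_lt T (ip (T x) x / ip x x + 1) x Tsa.
  by rewrite mulrDl mul1r divfK ?gt_eqF// ltrDl.
pose P := map_poly (real_complex R) (p - b%:P).
have P0 : P != 0.
  rewrite map_poly_eq0 subr_eq0; apply/eqP => h.
  by move: pt0; rewrite h hornerC leNgt b0.
have [rs Prs] := closed_field_poly_normal P.
apply: nb.
have -> : bop_horner p T - b%:C *: (1 : bop H) = chorner P T.
  by rewrite -bop_hornerE bop_hornerD bop_hornerN bop_hornerC.
have lP : lead_coef P != 0 by rewrite lead_coef_eq0.
have [|S [S1 S2]] := @chorner_prod_invertible T rs.
  move=> w wrs; apply: contrapT => nw.
  have wR := spectrum_real Tsa nw.
  have : root P w by rewrite Prs rootZ// root_prod_XsubC.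
  rewrite wR /root /P horner_map /= fmorph_eq0 hornerD hornerN hornerC.
  rewrite subr_eq0 => /eqP ph.
  by have := p0 (complex.Re w); rewrite -wR => /(_ nw); rewrite ph leNgt b0.
rewrite {1}Prs chornerZ; exists ((lead_coef P)^-1 *: S); split.
  by rewrite bopZMl bopZMr scalerA mulVf// scale1r.
by rewrite bopZMl bopZMr scalerA mulfV// scale1r.
Qed.

Lemma bop_horner_nm_le p T e : 0 <= e -> sa T ->
  (forall t, spectrum T t%:C -> `|p.[t]| <= e) ->
  forall x, nm (bop_horner p T x) <= e * nm x.
Proof.
move=> e0 Tsa pe x.
have := @bop_horner_psd ((e ^+ 2)%:P - p * p) T Tsa.
rewrite bop_hornerD bop_hornerC bop_hornerN bop_hornerM => /(_ _ x).
rewrite !bopE !ipE (sa_horner p Tsa) subr_ge0 => h.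
rewrite nm_leP ?mulr_ge0 ?nm_ge0// exprMn -ipxx; apply: h => t /pe.
rewrite !hornerE subr_ge0 -expr2 -real_normK ?num_real// => h.
by rewrite ler_pXn2r ?nnegrE.
Qed.

Lemma spectrum_ge T a t : sa T -> lower_bound T a -> spectrum T t%:C -> a <= t.
Proof.
move=> Tsa Ta; rewrite leNgt => nt; apply/negP => ta; apply: nt.
apply: spd_invertible; split; first exact/saB/(sa_scalar t).
exists (a - t) => [|x]; first by rewrite subr_gt0.
by rewrite !bopE !ipE mulrBl lerD2r.
Qed.

Lemma spectrum_le T a t : sa T -> upper_bound T a -> spectrum T t%:C -> t <= a.
Proof.
move=> Tsa Ta; rewrite leNgt => nt; apply/negP => ta; apply: nt.
have [|S [S1 S2]] := @spd_invertible _ _ (bop_scalar H t - T).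
  split; first exact/saB/Tsa/sa_scalar.
  exists (t - a) => [|x]; first by rewrite subr_gt0.
  by rewrite !bopE !ipE mulrBl lerD2l lerN2.
by exists (- S); rewrite -(opprB _ T); split; rewrite mulrNN.
Qed.

End Spectrum.

Section FunctionalCalculus.
Context {R : realType} {H : hilbertType R}.
Local Notation C := R[i].
Implicit Types (x y z : H) (a b c e : R) (S T : bop H) (p q : {poly R}).
Implicit Types (f g : R -> R) (D : set R).

Definition rspec T : set R := [set t | spectrum T t%:C].

Definition poly_approx D f := forall e, 0 < e ->
  exists p, forall t, D t -> `|p.[t] - f t| <= e.

Lemma le_eps a b c : (forall e, 0 < e -> a <= b + e * c) -> a <= b.
Proof.
move=> h; apply/ler_addgt0Pr => e e0.
have c0 : 0 < `|c| + 1 by rewrite ltr_wpDl.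
rewrite (le_trans (h _ (divr_gt0 e0 c0)))// lerD2l mulrAC ler_pdivrMr//.
by rewrite ler_pM2l// (le_trans (ler_norm _))// lerDl.
Qed.

Lemma fun_calcP f T S : is_fun_calc f T S <->
  forall e, 0 < e -> exists2 p, forall t, rspec T t -> `|p.[t] - f t| <= e &
    forall x, nm (bop_horner p T x - S x) <= e * nm x.
Proof.
split=> [[p [pf pS]] e e0|fS].
  have [N _ h1] := pf _ e0; have [M _ h2] := pS _ e0.
  exists (p (maxn N M)) => [t Tt|x].
    by apply: h1 => //=; rewrite leq_maxl.
  have /= := h2 (maxn N M) (leq_maxr _ _) x.
  by rewrite !normE -rmorphM lecR.
have /choice[p pP] n : exists p,
    (forall t, rspec T t -> `|p.[t] - f t| <= n.+1%:R^-1) /\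
    (forall x, nm (bop_horner p T x - S x) <= n.+1%:R^-1 * nm x).
  by have [|p p1 p2] := fS n.+1%:R^-1; [rewrite invr_gt0 | exists p].
exists p; split=> e e0; have [N _ hN] := near_infty_natSinv_lt (PosNum e0);
    exists N => // n /hN /= /ltW ne.
  by move=> t Tt; rewrite (le_trans ((pP n).1 t Tt)).
move=> x; rewrite !normE -rmorphM lecR /= (le_trans ((pP n).2 x))//.
by rewrite ler_wpM2r ?nm_ge0.
Qed.

Lemma fun_calc_exists f T : sa T -> poly_approx (rspec T) f ->
  exists S, is_fun_calc f T S.
Proof.
move=> Tsa fT.
have /choice[p pP] n : exists p,
    forall t, rspec T t -> `|p.[t] - f t| <= n.+1%:R^-1.
  by apply: fT; rewrite invr_gt0.
have near0 e : 0 < e -> exists N, forall n, (N <= n)%N -> n.+1%:R^-1 <= e.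
  move=> e0; have [N _ hN] := near_infty_natSinv_lt (PosNum e0).
  by exists N => n /hN /= /ltW.
have [e e0|S SP] := @bop_complete R H (fun n => bop_horner (p n) T).
  have [N hN] := near0 (e / 2) (divr_gt0 e0 (ltr0Sn R 1)).
  exists N => m n Nm Nn x.
  have -> : bop_horner (p m) T x - bop_horner (p n) T x =
      bop_horner (p m - p n) T x.
    by rewrite bop_hornerD bop_hornerN.
  apply: bop_horner_nm_le => //; first exact: ltW.
  move=> t Tt; rewrite hornerD hornerN.
  have h1 := le_trans (pP m t Tt) (hN m Nm).
  have h2 := le_trans (pP n t Tt) (hN n Nn).
  rewrite -(subrKA (f t)) (le_trans (ler_normD _ _))// [leRHS]splitr.
  by rewrite lerD// distrC.
exists S; apply/fun_calcP => e e0.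
have [N1 h1] := near0 _ e0; have [N2 h2] := SP _ e0.
exists (p (maxn N1 N2)) => [t Tt|]; last by apply: h2; rewrite leq_maxr.
by rewrite (le_trans (pP _ t Tt))// h1// leq_maxl.
Qed.

Lemma fun_calc_sa f T S : sa T -> is_fun_calc f T S -> sa S.
Proof.
move=> Tsa /fun_calcP fS x y; apply/eqP; rewrite -subr_eq0 -normr_le0.
apply: (@le_eps _ _ (2 * (nm x * nm y))) => e /fS[p _ pS].
have hsa := sa_horner p Tsa x y.
have -> : ip (S x) y - ip x (S y) =
    ip x (bop_horner p T y - S y) - ip (bop_horner p T x - S x) y.
  by rewrite !ipE hsa; lra.
have h1 := ip_le_nm x (bop_horner p T y - S y).
have h2 := ip_le_nm (bop_horner p T x - S x) y.
have h3 := ler_wpM2l (nm_ge0 x) (pS y).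
have h4 := ler_wpM2r (nm_ge0 y) (pS x).
by rewrite (le_trans (ler_normB _ _))//; lra.
Qed.

Lemma fun_calc_psd f T S : sa T -> is_fun_calc f T S ->
  (forall t, rspec T t -> 0 <= f t) -> psd S.
Proof.
move=> Tsa /fun_calcP fS f0 x.
apply: (@le_eps _ _ (2 * ip x x)) => e /fS[p pf pS].
have : psd (bop_horner (p + e%:P) T).
  apply: bop_horner_psd => // t Tt; rewrite hornerD hornerC.
  by have := pf t Tt; have := f0 t Tt; rewrite ler_norml => ft /andP[]; lra.
move=> /(_ x); rewrite bop_hornerD bop_hornerC !bopE !ipE => h1.
have h2 := ip_le_nm (bop_horner p T x - S x) x.
have h3 := ler_wpM2r (nm_ge0 x) (pS x).
have {h2 h3} : `|ip (bop_horner p T x - S x) x| <= e * ip x x.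
  by rewrite ipxx expr2 mulrA (le_trans h2).
rewrite !ipE ler_norml => /andP[]; lra.
Qed.

Lemma fun_calcC c T : is_fun_calc (fun=> c) T (bop_scalar H c).
Proof.
apply/fun_calcP => e e0; exists c%:P => [t _|x].
  by rewrite hornerC subrr normr0 ltW.
by rewrite bop_hornerC subrr nm0 mulr_ge0 ?nm_ge0// ltW.
Qed.

Lemma fun_calc_id T : is_fun_calc id T T.
Proof.
apply/fun_calcP => e e0; exists 'X => [t _|x].
  by rewrite hornerX subrr normr0 ltW.
by rewrite bop_hornerX subrr nm0 mulr_ge0 ?nm_ge0// ltW.
Qed.

Lemma fun_calcD f g T S S' : is_fun_calc f T S -> is_fun_calc g T S' ->
  is_fun_calc (fun t => f t + g t) T (S + S').
Proof.
move=> /fun_calcP fS /fun_calcP gS; apply/fun_calcP => e e0.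
have e20 : 0 < e / 2 by lra.
have [p pf pS] := fS _ e20; have [q qg qS] := gS _ e20.
exists (p + q) => [t Tt|x].
  rewrite hornerD opprD addrACA (le_trans (ler_normD _ _))//.
  by have := pf t Tt; have := qg t Tt; lra.
rewrite bop_hornerD !bopE opprD addrACA.
have := nm_triangle (bop_horner p T x - S x) 0 (- (bop_horner q T x - S' x)).
rewrite subr0 sub0r !opprK => /le_trans; apply.
by have := pS x; have := qS x; lra.
Qed.

Lemma nmZ c x : nm (c%:C *: x) = `|c| * nm x.
Proof.
apply/eqP; rewrite -(@eqrXn2 _ 2) ?mulr_ge0 ?nm_ge0// exprMn -!ipxx !ipE.
by rewrite real_normK ?num_real// mulrA expr2.
Qed.

Lemma fun_calcZ c f T S : is_fun_calc f T S ->
  is_fun_calc (fun t => c * f t) T (c%:C *: S).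
Proof.
move=> /fun_calcP fS; apply/fun_calcP => e e0.
have c0 : 0 < `|c| + 1 by rewrite ltr_wpDl.
have [p pf pS] := fS _ (divr_gt0 e0 c0).
have ce : `|c| * (e / (`|c| + 1)) <= e.
  by rewrite mulrCA ler_piMr ?(ltW e0)// ler_pdivrMr// mul1r lerDl.
exists (c *: p) => [t Tt|x].
  rewrite hornerZ -mulrBr normrM (le_trans _ ce)// ler_wpM2l//; exact: pf.
rewrite bop_hornerZ !bopE -scalerBr nmZ.
rewrite (le_trans (ler_wpM2l _ (pS x)))// mulrA ler_wpM2r ?nm_ge0//.
Qed.

Lemma fun_calcB f g T S S' : is_fun_calc f T S -> is_fun_calc g T S' ->
  is_fun_calc (fun t => f t - g t) T (S - S').
Proof.
move=> fS /(fun_calcZ (-1)); rewrite rmorphN scaleN1r => /(fun_calcD fS).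
by under eq_fun do rewrite mulN1r.
Qed.

Lemma fun_calcM f g T S S' B : sa T ->
  (forall t, rspec T t -> `|f t| <= B) ->
  (forall t, rspec T t -> `|g t| <= B) ->
  is_fun_calc f T S -> is_fun_calc g T S' ->
  is_fun_calc (fun t => f t * g t) T (S * S').
Proof.
move=> Tsa fB gB /fun_calcP fS /fun_calcP gS; apply/fun_calcP => e e0.
have [B1 B10 SB] := bop_bnd S'.
pose K := `|B| + 1 + B1; have K0 : 0 < K by rewrite addr_gt0// ltr_wpDl.
have nB : B <= `|B| by rewrite ler_norm.
pose d := Num.min 1 (e / (2 * K)).
have d0 : 0 < d by rewrite lt_min ltr01 divr_gt0// mulr_gt0.
have d1 : d <= 1 by rewrite ge_min lexx.
have dK : d * K <= e / 2.
  rewrite -ler_pdivlMr//; apply: (@le_trans _ _ (e / (2 * K))).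
    by rewrite ge_min lexx orbT.
  by rewrite invfM mulrA.
have [p pf pS] := fS _ d0; have [q qg qS] := gS _ d0.
have pB t : rspec T t -> `|p.[t]| <= `|B| + 1.
  move=> Tt; have := pf t Tt; have := fB t Tt.
  by have := ler_normD (p.[t] - f t) (f t); rewrite subrK; lra.
exists (p * q) => [t Tt|x].
  have -> : (p * q).[t] - f t * g t =
      p.[t] * (q.[t] - g t) + (p.[t] - f t) * g t.
    by rewrite hornerM; ring.
  rewrite (le_trans (ler_normD _ _))// !normrM.
  have h1 : `|p.[t]| * `|q.[t] - g t| <= (`|B| + 1) * d.
    by apply: ler_pM => //; [exact: pB | exact: qg].
  have h2 : `|p.[t] - f t| * `|g t| <= d * (`|B| + 1).
    apply: ler_pM => //; first exact: pf.
    by have := gB t Tt; lra.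
  move: dK h1 h2; rewrite /K => dK h1 h2; have := mulr_gt0 d0 B10; lra.
rewrite bop_hornerM !bopE.
have h1 : nm (bop_horner p T (bop_horner q T x - S' x)) <=
    d * (`|B| + 1) * nm x.
  rewrite (@le_trans _ _ ((`|B| + 1) * nm (bop_horner q T x - S' x)))//.
    by apply: bop_horner_nm_le => //; rewrite addr_ge0.
  by rewrite (mulrC d) -mulrA ler_wpM2l ?addr_ge0.
have h2 : nm (bop_horner p T (S' x) - S (S' x)) <= d * B1 * nm x.
  by rewrite (le_trans (pS _))// -mulrA ler_wpM2l// ltW.
rewrite (le_trans (nm_triangle _ (bop_horner p T (S' x)) _))//.
rewrite -bopNr -bopDr.
have := ler_wpM2r (nm_ge0 x) dK; rewrite /K; have := nm_ge0 x; nra.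
Qed.

Lemma fun_calc_lower f T S c : sa T -> is_fun_calc f T S ->
  (forall t, rspec T t -> c <= f t) -> lower_bound S c.
Proof.
move=> Tsa /fun_calcB/(_ (fun_calcC c T)) fS fc x.
have := fun_calc_psd Tsa fS _ x; rewrite !bopE !ipE subr_ge0; apply=> t /fc.
by rewrite subr_ge0.
Qed.

Lemma fun_calc_upper f T S c : sa T -> is_fun_calc f T S ->
  (forall t, rspec T t -> f t <= c) -> upper_bound S c.
Proof.
move=> Tsa /(fun_calcB (fun_calcC c T)) fS fc x.
have := fun_calc_psd Tsa fS _ x; rewrite !bopE !ipE subr_ge0; apply=> t /fc.
by rewrite subr_ge0.
Qed.

Lemma sa_quad_eq0 S : sa S -> (forall x, ip (S x) x = 0) -> S = 0.
Proof.
move=> Ssa S0; apply: bopP => x; apply: ip_eq0 => y.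
have := S0 (x + y); rewrite !bopE !ipE !S0 (Ssa y) (ipC y); lra.
Qed.

Lemma fun_calc_uniq f g T S S' : sa T -> is_fun_calc f T S ->
  is_fun_calc g T S' -> (forall t, rspec T t -> f t = g t) -> S = S'.
Proof.
move=> Tsa fS gS fg; apply/eqP; rewrite -subr_eq0; apply/eqP.
apply: sa_quad_eq0 => [|x]; first exact: fun_calc_sa Tsa (fun_calcB fS gS).
have := fun_calc_lower Tsa (fun_calcB fS gS) _ x.
have := fun_calc_upper Tsa (fun_calcB fS gS) _ x.
move=> /(_ 0) + /(_ 0); rewrite mul0r => h1 h2; apply/eqP.
by rewrite eq_le h1 ?h2// => t /fg ->; rewrite subrr.
Qed.

End FunctionalCalculus.

Section PowerApproximation.
Context {R : realType}.
Implicit Types (a b c e r s t : R) (p q : {poly R}) (f g : R -> R) (D : set R).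

Lemma midpoint_closed_set (E : R -> Prop) lo hi :
  E lo -> E hi ->
  (forall r s, lo <= r <= hi -> lo <= s <= hi -> E r -> E s ->
     E ((r + s) / 2)) ->
  (forall r, lo <= r <= hi -> (forall e, 0 < e -> exists s,
     [/\ lo <= s <= hi, E s & `|r - s| <= e]) -> E r) ->
  forall r, lo <= r <= hi -> E r.
Proof.
move=> Elo Ehi Emid Ecl r rlh; have /andP[lor rhi] := rlh.
have bisect n : exists u v, [/\ E u, E v, lo <= u <= r, r <= v <= hi &
    v - u <= 2^-1 ^+ n * (hi - lo)].
  elim: n => [|n [u [v [Eu Ev ur rv uv]]]].
    by exists lo, hi; rewrite expr0 mul1r !lexx lor rhi.
  have Em : E ((u + v) / 2) by apply: Emid => //; lra.
  rewrite exprS -mulrA; set w := _ * (hi - lo) in uv *.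
  by have [mr|rm] := leP ((u + v) / 2) r;
    [exists ((u + v) / 2), v | exists u, ((u + v) / 2)]; split => //; lra.
apply: Ecl => // e e0.
have h0 : 0 < hi - lo + 1 by lra.
have [||N hN] := @expr_lt_eps R 2^-1 _ _ _ (divr_gt0 e0 h0); [lra|lra|].
have [u [v [Eu Ev ur rv uv]]] := bisect N.
exists u; split => //; first lra.
rewrite ger0_norm; last lra.
have := hN _ (leqnn N); rewrite ler_pdivlMr//.
have : 0 <= (2^-1 : R) ^+ N by rewrite exprn_ge0.
nra.
Qed.

Lemma poly_approx_poly D p : poly_approx D (horner p).
Proof. by move=> e e0; exists p => t _; rewrite subrr normr0 ltW. Qed.

Lemma poly_approx_ext D f g : (forall t, D t -> f t = g t) ->
  poly_approx D f -> poly_approx D g.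
Proof.
by move=> fg fD e /fD[p pf]; exists p => t Dt; rewrite -fg// pf.
Qed.

Lemma poly_approx_lim D f : (forall e, 0 < e -> exists2 g, poly_approx D g &
    forall t, D t -> `|g t - f t| <= e) -> poly_approx D f.
Proof.
move=> fD e e0; have e20 : 0 < e / 2 by lra.
have [g gD gf] := fD _ e20; have [p pg] := gD _ e20; exists p => t Dt.
rewrite -(subrKA (g t)) (le_trans (ler_normD _ _))// [leRHS]splitr.
by rewrite lerD ?pg ?gf.
Qed.

Lemma poly_approxD D f g : poly_approx D f -> poly_approx D g ->
  poly_approx D (fun t => f t + g t).
Proof.
move=> fD gD e e0; have e20 : 0 < e / 2 by lra.
have [p pf] := fD _ e20; have [q qg] := gD _ e20; exists (p + q) => t Dt.
rewrite hornerD opprD addrACA (le_trans (ler_normD _ _))// [leRHS]splitr.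
by rewrite lerD ?pf ?qg.
Qed.

Lemma poly_approxZ D c f : poly_approx D f -> poly_approx D (fun t => c * f t).
Proof.
move=> fD e e0; have c0 : 0 < `|c| + 1 by rewrite ltr_wpDl.
have [p pf] := fD _ (divr_gt0 e0 c0); exists (c *: p) => t Dt.
rewrite hornerZ -mulrBr normrM (le_trans (ler_wpM2l _ (pf t Dt)))//.
by rewrite mulrCA ler_piMr ?(ltW e0)// ler_pdivrMr// mul1r lerDl.
Qed.

Lemma poly_approxM D B f g : (forall t, D t -> `|f t| <= B) ->
  (forall t, D t -> `|g t| <= B) ->
  poly_approx D f -> poly_approx D g -> poly_approx D (fun t => f t * g t).
Proof.
move=> fB gB fD gD e e0.
pose K := 2 * `|B| + 1; have K0 : 0 < K by rewrite ltr_wpDl// mulr_ge0.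
pose d := Num.min 1 (e / K).
have d0 : 0 < d by rewrite lt_min ltr01 divr_gt0.
have d1 : d <= 1 by rewrite ge_min lexx.
have dK : d * K <= e by rewrite -ler_pdivlMr// ge_min lexx orbT.
have [p pf] := fD _ d0; have [q qg] := gD _ d0; exists (p * q) => t Dt.
rewrite hornerM.
have -> : p.[t] * q.[t] - f t * g t =
    (p.[t] - f t) * (q.[t] - g t) + f t * (q.[t] - g t) + (p.[t] - f t) * g t.
  by ring.
rewrite !(le_trans (ler_normD _ _))//.
rewrite (le_trans (lerD (ler_normD _ _) (lexx _)))// !normrM.
have nB : B <= `|B| := ler_norm B.
have h1 : `|p.[t] - f t| * `|q.[t] - g t| <= d * 1.
  by apply: ler_pM => //; [exact: pf | rewrite (le_trans (qg t Dt))].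
have h2 : `|f t| * `|q.[t] - g t| <= `|B| * d.
  by apply: ler_pM => //; [rewrite (le_trans (fB t Dt)) | exact: qg].
have h3 : `|p.[t] - f t| * `|g t| <= d * `|B|.
  by apply: ler_pM => //; [exact: pf | rewrite (le_trans (gB t Dt))].
by move: dK; rewrite /K; lra.
Qed.

Lemma poly_approxV D a b : 0 < a -> a <= b ->
  (forall t, D t -> a <= t <= b) -> poly_approx D (fun t => t^-1).
Proof.
move=> a0 ab Dab e e0; have b0 : 0 < b := lt_le_trans a0 ab.
pose r := 1 - a / b.
have r0 : 0 <= r by rewrite subr_ge0 ler_pdivrMr// mul1r.
have r1 : r < 1 by rewrite ltrBlDr ltrDl divr_gt0.
have [N hN] := expr_lt_eps r0 r1 (mulr_gt0 e0 a0).
have [S SE] : exists S : {poly R},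
    (1 - b^-1 *: 'X) ^+ N - 1 = - (b^-1 *: 'X) * S.
  exists (\sum_(i < N) (1 - b^-1 *: 'X) ^+ i).
  by rewrite subrX1 addrAC subrr sub0r.
exists (b^-1 *: S) => t /Dab /andP[at_ tb].
have t0 : 0 < t := lt_le_trans a0 at_.
have E : (1 - b^-1 * t) ^+ N - 1 = - (t / b) * S.[t].
  by have := congr1 (horner^~ t) SE; rewrite !hornerE (mulrC t).
have -> : (b^-1 *: S).[t] - t^-1 = - (1 - b^-1 * t) ^+ N / t.
  have -> : (1 - b^-1 * t) ^+ N = 1 - t / b * S.[t] by move: E; lra.
  by rewrite hornerZ; field; rewrite !gt_eqF.
rewrite mulNr normrN normrM (@ger0_norm _ t^-1) ?invr_ge0 ?(ltW t0)//.
rewrite ler_pdivrMr// normrX.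
have u0 : 0 <= 1 - b^-1 * t by rewrite subr_ge0 mulrC ler_pdivrMr// mul1r.
rewrite ger0_norm// (@le_trans _ _ (r ^+ N))//.
  by rewrite lerXn2r ?nnegrE// /r lerD2l lerN2 (mulrC b^-1) ler_pM2r ?invr_gt0.
by rewrite (le_trans (hN _ (leqnn N)))// ler_pM2l.
Qed.

(* y' = y + (s^2 - y^2) / 2K increases to s, and the error s - y is multiplied
   by 1 - (s + y) / 2K at each step. *)
Lemma poly_approx_sqrt D g a b : 0 < a -> a <= b ->
  (forall t, D t -> a <= g t <= b) ->
  poly_approx D (fun t => g t ^+ 2) -> poly_approx D g.
Proof.
move=> a0 ab Dab g2D; have b0 : 0 < b := lt_le_trans a0 ab.
pose y := fix y n : R -> R := if n is n'.+1 then
  fun t => y n' t + (2 * b)^-1 * (g t ^+ 2 + -1 * (y n' t * y n' t))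
  else fun=> 0.
pose r := 1 - a / (2 * b).
have b20 : 0 < 2 * b by rewrite mulr_gt0.
have r0 : 0 <= r by rewrite subr_ge0 ler_pdivrMr//; lra.
have r1 : r < 1 by rewrite ltrBlDr ltrDl divr_gt0.
have yP n t : D t -> 0 <= y n t <= g t /\ g t - y n t <= b * r ^+ n.
  move=> /Dab /andP[ag gb]; elim: n => [|n [/andP[y0 yg] IH]] /=.
    rewrite lexx expr0 mulr1 subr0; split => //.
    by rewrite (le_trans _ ag) ?(ltW a0).
  set w := y n t in y0 yg IH *.
  pose k := 1 - (g t + w) / (2 * b).
  have E : g t - (w + (2 * b)^-1 * (g t ^+ 2 + -1 * (w * w))) = (g t - w) * k.
    by rewrite /k; field; rewrite gt_eqF.
  have k0 : 0 <= k by rewrite subr_ge0 ler_pdivrMr//; lra.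
  have kr : k <= r by rewrite /k /r lerD2l lerN2 ler_pM2r ?invr_gt0//; lra.
  have k1 : 0 <= (g t - w) * k by rewrite mulr_ge0// subr_ge0.
  rewrite E (exprSr r) (mulrA b); split; last first.
    by apply: ler_pM => //; rewrite subr_ge0.
  rewrite -[X in _ && X]subr_ge0 E k1 andbT addr_ge0//.
  rewrite mulr_ge0 ?invr_ge0 ?(ltW b20)//.
  by nra.
have yD n : poly_approx D (y n).
  elim: n => [|n IH] /=.
    by apply: poly_approx_ext (poly_approx_poly D 0) => t _; rewrite horner0.
  apply: poly_approxD => //; apply: poly_approxZ; apply: poly_approxD => //.
  apply: poly_approxZ; apply: (@poly_approxM _ b) => // t Dt;
    have [/andP[y0 yg] _] := yP n t Dt; have /andP[_ gb] := Dab t Dt;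
    by rewrite ger0_norm// (le_trans yg).
apply: poly_approx_lim => e e0.
have [N hN] := expr_lt_eps r0 r1 (divr_gt0 e0 b0).
exists (y N) => // t Dt; have [/andP[_ yg] h] := yP N t Dt.
rewrite distrC ger0_norm ?subr_ge0// (le_trans h)// mulrC -ler_pdivlMr//.
exact: hN.
Qed.

Lemma expR_lip c u v : u <= c -> v <= c ->
  `|expR u - expR v| <= expR c * `|u - v| :> R.
Proof.
have key u1 v1 : v1 <= u1 -> u1 <= c -> expR u1 - expR v1 <= expR c * (u1 - v1).
  move=> vu uc; apply: (@le_trans _ _ (expR u1 * (u1 - v1))).
    rewrite -[X in _ - expR X](subrKC u1) expRD -[X in X - _]mulr1 -mulrBr.
    rewrite ler_pM2l ?expR_gt0//; have := expR_ge1Dx (v1 - u1); lra.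
  by rewrite ler_wpM2r ?subr_ge0// ler_expR.
move=> uc vc; have [vu|/ltW uv] := leP v u.
  by rewrite !ger0_norm ?subr_ge0 ?ler_expR//; exact: key.
by rewrite distrC (distrC u) !ger0_norm ?subr_ge0 ?ler_expR//; exact: key.
Qed.

Definition log_bound a b : R := Num.max `|ln a| `|ln b|.

Lemma ln_le_log_bound a b t : 0 < a -> a <= t <= b -> `|ln t| <= log_bound a b.
Proof.
move=> a0 /andP[at_ tb]; have t0 : 0 < t := lt_le_trans a0 at_.
have b0 : 0 < b := lt_le_trans t0 tb.
have h1 : ln a <= ln t by rewrite ler_ln ?posrE.
have h2 : ln t <= ln b by rewrite ler_ln ?posrE.
rewrite /log_bound ler_norml; apply/andP; split.
  rewrite lerNl le_max; apply/orP; left.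
  by rewrite (@le_trans _ _ (- ln a)) ?lerN2// -normrN ler_norm.
by rewrite le_max (le_trans h2 (ler_norm _)) orbT.
Qed.

Lemma powR_bounds a b r t : 0 < a -> a <= t <= b -> -1 <= r <= 1 ->
  expR (- log_bound a b) <= t `^ r <= expR (log_bound a b).
Proof.
move=> a0 tab r1; have /andP[at_ _] := tab.
have t0 : 0 < t := lt_le_trans a0 at_.
rewrite /powR gt_eqF// !ler_expR -ler_norml normrM.
rewrite (le_trans _ (ln_le_log_bound a0 tab))// ler_piMl// ler_norml.
exact: r1.
Qed.

Lemma powR_lip a b r s t : 0 < a -> a <= t <= b ->
  -1 <= r <= 1 -> -1 <= s <= 1 ->
  `|t `^ r - t `^ s| <= expR (log_bound a b) * log_bound a b * `|r - s|.
Proof.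
move=> a0 tab r1 s1; have /andP[at_ _] := tab.
have t0 : 0 < t := lt_le_trans a0 at_.
have lt_ := ln_le_log_bound a0 tab.
have le_ u : -1 <= u <= 1 -> u * ln t <= log_bound a b.
  move=> u1; rewrite (le_trans (ler_norm _))// normrM (le_trans _ lt_)//.
  by rewrite ler_piMl// ler_norml.
rewrite /powR gt_eqF// (le_trans (expR_lip (le_ _ r1) (le_ _ s1)))//.
rewrite -mulrA ler_pM2l ?expR_gt0// -mulrBl normrM mulrC.
by rewrite ler_wpM2r.
Qed.

Lemma log_bound_ge0 a b : 0 <= log_bound a b.
Proof. by rewrite /log_bound le_max normr_ge0. Qed.

Lemma poly_approx_powR D a b r : 0 < a -> a <= b ->
  (forall t, D t -> a <= t <= b) -> -1 <= r <= 1 ->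
  poly_approx D (fun t => t `^ r).
Proof.
move=> a0 ab Dab; have Dpos t : D t -> 0 < t.
  by move=> /Dab /andP[at_ _]; exact: lt_le_trans at_.
pose lb := log_bound a b.
have bnd v : -1 <= v <= 1 -> forall t, D t -> `|t `^ v| <= expR lb.
  move=> v1 t /Dab tab; rewrite ger0_norm ?powR_ge0//.
  by have /andP[] := powR_bounds a0 tab v1.
apply: (midpoint_closed_set (E := fun r => poly_approx D (fun t => t `^ r))).
- apply: poly_approx_ext (poly_approxV a0 ab Dab) => t /Dpos t0.
  by rewrite powR_inv1// ltW.
- apply: poly_approx_ext (poly_approx_poly D 'X) => t /Dpos t0.
  by rewrite hornerX powRr1// ltW.
- move=> s u s1 u1 sD uD.
  have L0 : 0 <= lb := log_bound_ge0 a b.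
  apply: (@poly_approx_sqrt _ _ (expR (- lb)) (expR lb)).
  + exact: expR_gt0.
  + by rewrite ler_expR; lra.
  + by move=> t /Dab tab; apply: powR_bounds => //; lra.
  apply: (@poly_approx_ext _ (fun t => t `^ s * t `^ u)) => [t /Dpos t0|].
    rewrite expr2 -!powRD ?(gt_eqF t0) ?implybT//.
    by congr (_ `^ _); lra.
  apply: (@poly_approxM _ (expR lb) (fun t => t `^ s) (fun t => t `^ u)) => //;
    exact: bnd.
- move=> s s1 sE; apply: poly_approx_lim => e e0.
  pose L := expR lb * lb.
  have L0 : 0 <= L by rewrite mulr_ge0 ?expR_ge0 ?log_bound_ge0.
  have L1 : 0 < L + 1 by lra.
  have [u [u1 uD us]] := sE _ (divr_gt0 e0 L1).
  exists (fun t => t `^ u) => // t /Dab tab.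
  rewrite (le_trans (powR_lip a0 tab u1 s1))// distrC -/lb -/L.
  rewrite (le_trans (ler_wpM2l L0 us))// mulrCA ler_piMr ?(ltW e0)//.
  by rewrite ler_pdivrMr// mul1r lerDl.
Qed.

End PowerApproximation.

Section OperatorPowers.
Context {R : realType} {H : hilbertType R}.
Implicit Types (x y z : H) (a b c e r s t : R) (S T : bop H).

Lemma spd_bounds T : spd T -> exists a b,
  [/\ 0 < a, a <= b, lower_bound T a, upper_bound T b &
      forall t, rspec T t -> a <= t <= b].
Proof.
move=> [Tsa [a a0 Ta]]; have [K K0 TK] := quad_bounded T.
have Tb : upper_bound T (a + K).
  move=> x; rewrite (le_trans (ler_norm _))// (le_trans (TK x))//.
  by rewrite ler_wpM2r ?ipxx_ge0// lerDr (ltW a0).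
exists a, (a + K); split=> //; first by rewrite lerDl (ltW K0).
by move=> t Tt; rewrite (spectrum_ge Tsa Ta Tt) (spectrum_le Tsa Tb Tt).
Qed.

Lemma rspec_gt0 T t : spd T -> rspec T t -> 0 < t.
Proof.
move=> /spd_bounds[a [b [a0 _ _ _ Tab]]] /Tab /andP[at_ _].
exact: lt_le_trans at_.
Qed.

Lemma pow_fun_calc T r : spd T -> -1 <= r <= 1 ->
  is_fun_calc (fun t => t `^ r) T (T ^op r).
Proof.
move=> Tspd r1; have [a [b [a0 ab _ _ Tab]]] := spd_bounds Tspd.
apply: (@xgetPex _ 0).
exact: fun_calc_exists Tspd.1 (poly_approx_powR a0 ab Tab r1).
Qed.

Lemma pow_sa T r : spd T -> -1 <= r <= 1 -> sa (T ^op r).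
Proof. by move=> Tspd r1; apply: fun_calc_sa Tspd.1 (pow_fun_calc Tspd r1). Qed.

Lemma pow_spd T r : spd T -> -1 <= r <= 1 -> spd (T ^op r).
Proof.
move=> Tspd r1; split; first exact: pow_sa.
have [a [b [a0 ab _ _ Tab]]] := spd_bounds Tspd.
exists (expR (- log_bound a b)); first exact: expR_gt0.
apply: fun_calc_lower Tspd.1 (pow_fun_calc Tspd r1) _ => t /Tab tab.
by have /andP[] := powR_bounds a0 tab r1.
Qed.

Lemma powD T r s : spd T -> -1 <= r <= 1 -> -1 <= s <= 1 -> -1 <= r + s <= 1 ->
  (T ^op r) * (T ^op s) = T ^op (r + s).
Proof.
move=> Tspd r1 s1 rs1; have [a [b [a0 ab _ _ Tab]]] := spd_bounds Tspd.
have bnd v : -1 <= v <= 1 ->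
    forall t, rspec T t -> `|t `^ v| <= expR (log_bound a b).
  move=> v1 t /Tab tab; rewrite ger0_norm ?powR_ge0//.
  by have /andP[] := powR_bounds a0 tab v1.
apply: fun_calc_uniq Tspd.1 _ (pow_fun_calc Tspd rs1) _.
  by apply: fun_calcM Tspd.1 (bnd r r1) (bnd s s1) _ _; exact: pow_fun_calc.
by move=> t /(rspec_gt0 Tspd) t0; rewrite /= powRD// (gt_eqF t0) implybT.
Qed.

Lemma pow0 T : spd T -> T ^op 0 = 1.
Proof.
move=> Tspd; have r1 : -1 <= (0 : R) <= 1 by lra.
rewrite -(scale1r (1 : bop H)).
apply: fun_calc_uniq Tspd.1 (pow_fun_calc Tspd r1) (fun_calcC 1 T) _ => t _.
by rewrite powRr0.
Qed.

Lemma pow1 T : spd T -> T ^op 1 = T.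
Proof.
move=> Tspd; have r1 : -1 <= (1 : R) <= 1 by lra.
apply: fun_calc_uniq Tspd.1 (pow_fun_calc Tspd r1) (fun_calc_id T) _ => t Tt.
by rewrite powRr1// (ltW (rspec_gt0 Tspd Tt)).
Qed.

Lemma pow_inverse T r : spd T -> -1 <= r <= 1 ->
  bop_inverse (T ^op r) (T ^op (- r)).
Proof.
move=> Tspd r1; have [n1 z1] : -1 <= - r <= 1 /\ -1 <= (0 : R) <= 1 by lra.
by split; rewrite powD ?addNr ?subrr ?pow0.
Qed.

Lemma pow_invE T : spd T -> bop_inv T = T ^op (-1).
Proof.
move=> Tspd; apply: bop_invE; rewrite -{1}(pow1 Tspd); apply: pow_inverse => //.
lra.
Qed.

Lemma pow_upper T c r : spd T -> upper_bound T c -> 0 <= r <= 1 ->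
  upper_bound (T ^op r) (c `^ r).
Proof.
move=> Tspd Tc r01; have r1 : -1 <= r <= 1 by lra.
apply: fun_calc_upper Tspd.1 (pow_fun_calc Tspd r1) _ => t Tt.
have t0 := rspec_gt0 Tspd Tt; have tc := spectrum_le Tspd.1 Tc Tt.
apply: ge0_ler_powR; rewrite ?nnegrE ?(ltW t0) ?(le_trans (ltW t0) tc)//.
by lra.
Qed.

Lemma pow_lower T c r : spd T -> upper_bound T c -> -1 <= r <= 0 ->
  lower_bound (T ^op r) (c `^ r).
Proof.
move=> Tspd Tc r01; have r1 : -1 <= r <= 1 by lra.
apply: fun_calc_lower Tspd.1 (pow_fun_calc Tspd r1) _ => t Tt.
have t0 := rspec_gt0 Tspd Tt; have tc := spectrum_le Tspd.1 Tc Tt.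
have c0 : 0 < c := lt_le_trans t0 tc.
rewrite -(opprK r) !(powRN _ (- r)) lef_pV2 ?posrE ?powR_gt0//.
by apply: ge0_ler_powR; rewrite ?nnegrE ?(ltW t0) ?(ltW c0)//; lra.
Qed.

Lemma pow_quad_lip T k : spd T -> 0 < k -> exists2 L, 0 <= L &
  forall r s x, -1 <= r <= 1 -> -1 <= s <= 1 ->
  `|k `^ r * ip ((T ^op r) x) x - k `^ s * ip ((T ^op s) x) x|
    <= L * `|r - s| * ip x x.
Proof.
move=> Tspd k0; have [a [b [a0 ab _ _ Tab]]] := spd_bounds Tspd.
pose L := expR (log_bound (k * a) (k * b)) * log_bound (k * a) (k * b).
exists L => [|r s x r1 s1]; first by rewrite mulr_ge0 ?expR_ge0 ?log_bound_ge0.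
pose f t := k `^ r * t `^ r - k `^ s * t `^ s.
have fS : is_fun_calc f T ((k `^ r)%:C *: (T ^op r) - (k `^ s)%:C *: (T ^op s)).
  by apply: fun_calcB; apply: fun_calcZ; exact: pow_fun_calc.
have fL t : rspec T t -> `|f t| <= L * `|r - s|.
  move=> Tt; have t0 := rspec_gt0 Tspd Tt; have /andP[at_ tb] := Tab t Tt.
  rewrite /f -!powRM ?(ltW k0) ?(ltW t0)//; apply: powR_lip => //.
    exact: mulr_gt0.
  by rewrite !ler_pM2l// at_.
have h1 := fun_calc_upper Tspd.1 fS (c := L * `|r - s|) _ x.
have h2 := fun_calc_lower Tspd.1 fS (c := - (L * `|r - s|)) _ x.
rewrite ler_norml -mulNr; move: h1 h2; rewrite !bopE !ipE => h1 h2.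
by rewrite h1 ?h2// => t /fL; rewrite ler_norml => /andP[].
Qed.

End OperatorPowers.

Section OperatorInequalities.
Context {R : realType} {H : hilbertType R}.
Implicit Types (x y z : H) (a b c e r s t k : R) (S T P Q U V W : bop H).

Lemma bounded_below_invertible S c : sa S -> 0 < c ->
  (forall x, c * nm x <= nm (S x)) -> exists S', bop_inverse S S'.
Proof.
move=> Ssa c0 Sc; have [|S' [l r]] := @spd_invertible _ _ (S * S).
  split; first exact: saM.
  exists (c ^+ 2) => [|x]; first by rewrite exprn_gt0.
  rewrite bopME Ssa !ipxx -exprMn.
  by rewrite lerXn2r ?nnegrE ?mulr_ge0 ?nm_ge0 ?(ltW c0).
exists (S' * S); have l1 : S' * S * S = 1 by rewrite -mulrA.
have r1 : S * (S * S') = 1 by rewrite mulrA.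
split=> //; rewrite -[RHS]r1; congr (_ * _).
by rewrite -[LHS]mulr1 -[X in _ * X = _]r1 [LHS]mulrA l1 mul1r.
Qed.

(* If D - W had a negative spectral value b, then D - W - b would be bounded
   below, since (D - W) x = b x + v with v small would make
   2 <(D - W) x, D x> negative, whereas it is at least |(D - W) x|^2. *)
Lemma quad_le_of_sqr_le W D : sa W -> spd D ->
  (forall x, ip (W x) (W x) <= ip (D x) (D x)) ->
  forall x, ip (W x) x <= ip (D x) x.
Proof.
move=> Wsa [Dsa [d d0 Dd]] WD x; rewrite leNgt; apply/negP => lt_x.
pose E := D - W; have Esa : sa E by exact: saB.
have [|b b0 nb] := @spectrum_lt _ _ E 0 x Esa.
  by rewrite mul0r /E !bopE !ipE subr_lt0.
have [K K0 DK] := bop_bnd D; apply: nb.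
pose c := - b * d / K.
have c0 : 0 < c by rewrite divr_gt0// mulr_gt0// oppr_gt0.
apply: (@bounded_below_invertible _ c) => //.
  by apply: saB => //; exact: (sa_scalar b).
move=> y; set S := E - _; pose v := S y.
have [y0|y0] := eqVneq (nm y) 0; first by rewrite y0 mulr0 nm_ge0.
have ypos : 0 < nm y by rewrite lt_neqAle eq_sym y0 nm_ge0.
have Wy : W y = D y - (b%:C *: y + v).
  rewrite /v /S /E !bopE; apply/eqP; rewrite eq_sym subr_eq; apply/eqP.
  by rewrite (addrC (_ *: y)) subrK addrC subrK.
have h1 := WD y; have h2 := Dd y.
have h3 := ip_le_nm v (D y); have h4 := ler_wpM2l (nm_ge0 v) (DK y).
have h5 := ipxx_ge0 (b%:C *: y + v).
have h6 : 0 <= 2 * (b * ip y (D y) + ip v (D y)).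
  move: h1 h5; rewrite Wy; set w := b%:C *: y + v.
  have -> : b * ip y (D y) + ip v (D y) = ip w (D y) by rewrite /w !ipE.
  clearbody w; rewrite !ipE (ipC (D y) w); lra.
rewrite /c -/v (mulrAC _ K^-1) ler_pdivrMr// -(ler_pM2r ypos) -!mulrA -expr2.
rewrite -ipxx; rewrite ipC in h6; rewrite ler_norml in h3.
have /andP[_ h3'] := h3.
have h7 := ler_wnM2l (ltW b0) h2; lra.
Qed.

Lemma inverse_antitone S T S' T' : sa S -> psd S -> sa T ->
  (forall x, ip (S x) x <= ip (T x) x) ->
  bop_inverse S S' -> bop_inverse T T' ->
  forall x, ip (T' x) x <= ip (S' x) x.
Proof.
move=> Ssa S0 Tsa ST [_ SS'] [_ TT'] x.
pose u := T' x; pose v := S' x.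
have Su : S v = x by rewrite /v -bopME SS'.
have Tu : T u = x by rewrite /u -bopME TT'.
have h1 := S0 (v - u); have h2 := ST u.
by move: h1 h2; rewrite -/u -/v !bopE !ipE Tu Su (Ssa u v) Su (ipC u) (ipC v);
  lra.
Qed.

Lemma sum_square_ge0 U V S T W a b c e k x y : sa U -> sa V ->
  U * U = S -> V * U = T -> V * V = W -> a * a = c -> a * b = e -> b * b = k ->
  0 <= c * ip (S x) x + 2 * (e * ip (T x) y) + k * ip (W y) y.
Proof.
move=> Usa Vsa <- <- <- <- <- <-.
have := ipxx_ge0 (a%:C *: U x + b%:C *: V y).
rewrite !bopE !ipE (Usa (U x)) (Vsa (V y)) (Vsa (U x)) (ipC (V y) (U x)).
by congr (0 <= _); ring.
Qed.

Lemma powDE T r s t : spd T -> -1 <= r <= 1 -> -1 <= s <= 1 -> -1 <= t <= 1 ->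
  r + s = t -> (T ^op r) * (T ^op s) = T ^op t.
Proof. by move=> Tspd r1 s1 t1 rs; rewrite powD ?rs. Qed.

Lemma powR_addE k r s t : 0 < k -> r + s = t -> k `^ r * k `^ s = k `^ t.
Proof. by move=> k0 <-; rewrite powRD// (gt_eqF k0) implybT. Qed.

Lemma pow_block P k r s x y : spd P -> 0 < k -> 0 <= r <= 1 -> 0 <= s <= 1 ->
  0 <= k `^ r * ip ((P ^op r) x) x
     + 2 * (k `^ ((r + s) / 2) * ip ((P ^op ((r + s) / 2)) x) y)
     + k `^ s * ip ((P ^op s) y) y.
Proof.
move=> Pspd k0 r01 s01.
apply: (@sum_square_ge0 (P ^op (r / 2)) (P ^op (s / 2)) _ _ _
                        (k `^ (r / 2)) (k `^ (s / 2))).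
- by apply: pow_sa => //; lra.
- by apply: pow_sa => //; lra.
- by apply: powDE => //; lra.
- by apply: powDE => //; lra.
- by apply: powDE => //; lra.
- by apply: powR_addE => //; lra.
- by apply: powR_addE => //; lra.
- by apply: powR_addE => //; lra.
Qed.

(* Conjugating by T^(-r/2) reduces to the case r = 0, where the block inequality
   says W^2 <= D^2 for W = T^(-r/2) Z T^(-r/2) and D = T^((s-r)/2). *)
Lemma quad_le_of_block T r s Z : spd T -> sa Z -> 0 <= r <= 1 -> 0 <= s <= 1 ->
  (forall x y,
     0 <= ip ((T ^op r) x) x + 2 * ip (Z x) y + ip ((T ^op s) y) y) ->
  forall x, ip (Z x) x <= ip ((T ^op ((r + s) / 2)) x) x.
Proof.
move=> Tspd Zsa r01 s01 blk x.
pose V := T ^op (- (r / 2)); pose U := T ^op (r / 2).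
pose D := T ^op ((s - r) / 2).
have Vsa : sa V by apply: pow_sa => //; lra.
have Usa : sa U by apply: pow_sa => //; lra.
have Dspd : spd D by apply: pow_spd => //; lra.
have VU : V * U = 1.
  by transitivity (T ^op 0); [apply: powDE => //; lra | exact: pow0].
have UV : U * V = 1.
  by transitivity (T ^op 0); [apply: powDE => //; lra | exact: pow0].
have UU : U * U = T ^op r by apply: powDE => //; lra.
have DD : D * D = V * (T ^op s) * V.
  transitivity (T ^op (s - r)); first by apply: powDE => //; lra.
  transitivity (T ^op (s - r / 2) * V).
    by apply: esym; apply: powDE => //; lra.
  by congr (_ * _); apply: esym; apply: powDE => //; lra.
have UDU : U * D * U = T ^op ((r + s) / 2).
  transitivity (T ^op (s / 2) * U); last by apply: powDE => //; lra.
  by congr (_ * _); apply: powDE => //; lra.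
pose W := V * Z * V; have Wsa : sa W by exact: saMM.
have WE z : W z = V (Z (V z)) by [].
have {VU} VU z : V (U z) = z by rewrite -bopME VU.
have {UV} UV z : U (V z) = z by rewrite -bopME UV.
clearbody U V D W.
have WD z : ip (W z) (W z) <= ip (D z) (D z).
  have := blk (- V (W z)) (V z).
  have -> : ip ((T ^op r) (- V (W z))) (- V (W z)) = ip (W z) (W z).
    by rewrite bopNr !ipE opprK -UU bopME Usa UV.
  have -> : ip (Z (- V (W z))) (V z) = - ip (W z) (W z).
    by rewrite bopNr !ipE -Vsa -WE Wsa.
  have -> : ip ((T ^op s) (V z)) (V z) = ip (D z) (D z).
    by rewrite -Dspd.1 -(bopME D D) DD !bopME Vsa.
  lra.
have := quad_le_of_sqr_le Wsa Dspd WD (U x).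
by rewrite -UDU !bopME Usa WE Vsa VU.
Qed.

Lemma spd_mean P Q a b : 0 < a -> 0 < b -> spd P -> spd Q ->
  spd ((2^-1)%:C *: (a%:C *: P + b%:C *: Q)).
Proof.
move=> a0 b0 [Psa [d d0 Pd]] [Qsa [e e0 Qe]].
split; first by apply/saZ/saD; exact: saZ.
exists (2^-1 * (a * d)) => [|x]; first by rewrite !mulr_gt0.
rewrite !bopE !ipE -mulrA ler_pM2l// -mulrA.
rewrite (@le_trans _ _ (a * ip (P x) x))//; first by rewrite ler_pM2l.
rewrite lerDl mulr_ge0 ?(ltW b0)// (le_trans _ (Qe x))//.
by rewrite mulr_ge0 ?ipxx_ge0// ltW.
Qed.

Lemma mean_block_ge0 (p q p' q' p'' q'' u v : R) :
  0 <= q + 2 * q' + q'' -> 0 <= p + 2 * p' + p'' ->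
  2^-1 * (p'' + q'') <= v -> 2^-1 * (p + q) <= u ->
  0 <= u + 2 * (2^-1 * (p' + q')) + v.
Proof. lra. Qed.

Lemma mean_perturbation (p q u p' q' u' e1 e2 e3 : R) :
  2^-1 * p' + 2^-1 * q' <= u' ->
  `|p - p'| <= e1 -> `|q - q'| <= e2 -> `|u - u'| <= e3 ->
  2^-1 * p + 2^-1 * q <= u + (e1 + e2 + e3).
Proof.
rewrite !ler_norml => h /andP[? ?] /andP[? ?] /andP[? ?]; lra.
Qed.

Lemma pow_concave_subproof P Q X a b r x : 0 < a -> 0 < b ->
  spd P -> spd Q -> spd X ->
  (forall z, ip (X z) z = 2^-1 * (a * ip (P z) z + b * ip (Q z) z)) ->
  0 <= r <= 1 ->
  2^-1 * (a `^ r * ip ((P ^op r) x) x + b `^ r * ip ((Q ^op r) x) x) <=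
  ip ((X ^op r) x) x.
Proof.
move=> a0 b0 Pspd Qspd Xspd XE r01.
pose Y s : bop H := (2^-1)%:C *:
  ((a `^ s)%:C *: (P ^op s) + (b `^ s)%:C *: (Q ^op s)).
have YE s z w : ip (Y s z) w =
    2^-1 * (a `^ s * ip ((P ^op s) z) w + b `^ s * ip ((Q ^op s) z) w).
  by rewrite bopZE ipZl bopDE ipDl !bopZE !ipZl.
have Ysa u : 0 <= u <= 1 -> sa (Y u).
  by move=> u01; apply/saZ/saD; apply/saZ/pow_sa => //; lra.
clearbody Y.
suff E : forall s, 0 <= s <= 1 -> forall z, ip (Y s z) z <= ip ((X ^op s) z) z.
  by rewrite -YE; exact: E.
apply: (midpoint_closed_set
  (E := fun s => forall z, ip (Y s z) z <= ip ((X ^op s) z) z)).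
- by move=> z; rewrite YE !pow0// !powRr0 !mul1r; set w := ip _ _; lra.
- by move=> z; rewrite YE !pow1// !powRr1 ?(ltW a0) ?(ltW b0)// XE.
- move=> s u s01 u01 Es Eu.
  apply: (quad_le_of_block Xspd) => //; first by apply: Ysa; lra.
  move=> y z; have := Es y; have := Eu z; rewrite !YE.
  have := pow_block y z Pspd a0 s01 u01; have := pow_block y z Qspd b0 s01 u01.
  exact: mean_block_ge0.
- move=> s s01 sE z.
  have [L1 L10 h1] := pow_quad_lip Pspd a0.
  have [L2 L20 h2] := pow_quad_lip Qspd b0.
  have [L3 L30 h3] := pow_quad_lip Xspd (ltr01 : 0 < (1 : R)).
  apply: (@le_eps _ _ _ ((L1 + L2 + L3) * ip z z)) => e e0.
  have [u [u01 Eu us]] := sE _ e0.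
  have [s1 u1] : -1 <= s <= 1 /\ -1 <= u <= 1 by lra.
  have z0 := ipxx_ge0 z.
  have step (L A B : R) : 0 <= L -> `|A - B| <= L * `|s - u| * ip z z ->
      `|A - B| <= e * (L * ip z z).
    move=> L0 h; rewrite (le_trans h)// mulrA (mulrC e) ler_wpM2r//.
    by rewrite ler_wpM2l.
  have := step _ _ _ L30 (h3 s u z s1 u1).
  have := step _ _ _ L20 (h2 s u z s1 u1).
  have := step _ _ _ L10 (h1 s u z s1 u1).
  rewrite !powR1 !mul1r; have := Eu z; rewrite !YE !mulrDl !mulrDr.
  exact: mean_perturbation.
Qed.

Lemma pow_concave P Q a b r x : 0 < a -> 0 < b -> spd P -> spd Q ->
  0 <= r <= 1 ->
  2^-1 * (a `^ r * ip ((P ^op r) x) x + b `^ r * ip ((Q ^op r) x) x) <=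
  ip ((((2^-1)%:C *: (a%:C *: P + b%:C *: Q)) ^op r) x) x.
Proof.
move=> a0 b0 Pspd Qspd r01; apply: pow_concave_subproof => //.
  exact: spd_mean.
by move=> z; rewrite !bopE !ipE.
Qed.

Lemma sandwich_quad_le U V s x : sa U -> sa V -> 0 < s ->
  ip ((U * V * U) x) x <=
  2^-1 * (s^-1 * ip ((U * U) x) x + s * ip ((U * (V * V) * U) x) x).
Proof.
move=> Usa Vsa s0; rewrite !bopE !(Usa _ x) (Vsa (V (U x))).
have := ipxx_ge0 (U x - s%:C *: V (U x)).
rewrite !ipE (ipC (V (U x)) (U x)) (ipC (U x) (V (U x))).
move: (ip (U x) (U x)) (ip (V (U x)) (U x)) (ip (V (U x)) (V (U x))) => p q w h.
rewrite -(ler_pM2l s0).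
have -> : s * (2^-1 * (s^-1 * p + s * w)) = 2^-1 * (p + s * (s * w)).
  by field; rewrite gt_eqF.
by lra.
Qed.

Lemma spd_conj T U U' : spd T -> sa U -> bop_inverse U U' -> spd (U * T * U).
Proof.
move=> [Tsa [d d0 Td]] Usa [UU _]; split; first exact: saMM.
have [K K0 UK] := bop_bnd U'.
exists (d / K ^+ 2) => [|x]; first by rewrite divr_gt0// exprn_gt0.
rewrite !bopE Usa (le_trans _ (Td _))// -mulrA ler_pM2l//.
rewrite ler_pdivrMl ?exprn_gt0// !ipxx -exprMn.
rewrite lerXn2r ?nnegrE ?mulr_ge0 ?nm_ge0 ?(ltW K0)//.
by rewrite (le_trans _ (UK (U x)))// -bopME UU.
Qed.

Lemma geometric_mean_bounds P Q P' Q' : spd P -> spd Q ->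
  bop_inverse P P' -> bop_inverse Q Q' -> exists G',
  [/\ spd (P #op Q), bop_inverse (P #op Q) G',
      forall s x, 0 < s -> ip ((P #op Q) x) x <=
        2^-1 * (s^-1 * ip (P x) x + s * ip (Q x) x)
    & forall s x, 0 < s -> ip (G' x) x <=
        2^-1 * (s^-1 * ip (P' x) x + s * ip (Q' x) x)].
Proof.
move=> Pspd Qspd PP' QQ'.
have h2 : -1 <= (2^-1 : R) <= 1 by lra.
have n2 : -1 <= - (2^-1 : R) <= 1 by lra.
have half T : spd T -> (T ^op 2^-1) * (T ^op 2^-1) = T.
  by move=> Ts; transitivity (T ^op 1); [apply: powDE => //; lra | exact: pow1].
rewrite /geometric_mean.
pose U := P ^op 2^-1; pose V := P ^op (- 2^-1); rewrite -/U -/V.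
have Usa : sa U by exact: pow_sa.
have Vsa : sa V by exact: pow_sa.
have UV : bop_inverse U V by exact: pow_inverse.
have VU := bop_inverse_sym UV.
pose C := V * Q * V; rewrite -/C; have Cspd : spd C by exact: spd_conj VU.
pose D := C ^op 2^-1; pose E := C ^op (- 2^-1); rewrite -/D.
have Dspd : spd D by exact: pow_spd.
have Esa : sa E by exact: pow_sa.
have DE : bop_inverse D E by exact: pow_inverse.
have UU : U * U = P by exact: half.
have DD : D * D = C by exact: half.
have UCU : U * C * U = Q.
  by rewrite /C !mulrA (proj2 UV) mul1r -mulrA (proj1 UV) mulr1.
exists (V * E * V); split.
- exact: spd_conj UV.
- by rewrite -mulrA; do 2?[apply: bop_inverseM => //].
- by move=> s x s0; have := sandwich_quad_le x Usa Dspd.1 s0; rewrite UU DD UCU.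
- move=> s x s0; have := sandwich_quad_le x Vsa Esa s0.
  have -> : V * V = P'.
    by apply: bop_inverse_uniq PP'; rewrite -UU; exact: bop_inverseM.
  have -> : V * (E * E) * V = Q'.
    apply: bop_inverse_uniq QQ'; rewrite -UCU -DD -mulrA.
    by do 3?[apply: bop_inverseM => //].
  exact.
Qed.

End OperatorInequalities.

Section KantorovichBound.
Context {R : realType} {H : hilbertType R}.
Implicit Types (x y z : H) (a b c e r s t k m M : R) (S T : bop H).

Lemma spd_bop_pos T : spd T -> bop_pos T.
Proof.
move=> [Tsa [d d0 Td]]; apply/bop_posP; split=> // x.
by rewrite (le_trans _ (Td x))// mulr_ge0 ?ipxx_ge0// ltW.
Qed.

Lemma inverse_psd T S : spd T -> bop_inverse T S -> psd S.
Proof.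
move=> Tspd [ST TS] x; have [Tsa T0] := (bop_posP T).1 (spd_bop_pos Tspd).
by rewrite -[X in ip _ X]bop1E -TS bopME -Tsa.
Qed.

Lemma positive_map_le (Phi : {linear bop H -> bop H}) S T :
  positive_map Phi -> S <=op T -> Phi S <=op Phi T.
Proof. by move=> Phi0 ST; rewrite /bop_le -raddfB; apply: Phi0. Qed.

Lemma normalized_scalar (Phi : {linear bop H -> bop H}) c :
  normalized_map Phi -> Phi (bop_scalar H c) = bop_scalar H c.
Proof. by move=> Phi1; rewrite /bop_scalar linearZ /= Phi1. Qed.

Lemma bop_le_scalar_upper T c : sa T ->
  T <=op bop_scalar H c <-> upper_bound T c.
Proof.
move=> Tsa; rewrite (bop_leP Tsa (sa_scalar c)).
by split=> h x; have := h x; rewrite !bopE !ipE.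
Qed.

Lemma bop_le_scalar_lower T c : sa T ->
  bop_scalar H c <=op T <-> lower_bound T c.
Proof.
move=> Tsa; rewrite (bop_leP (sa_scalar c) Tsa).
by split=> h x; have := h x; rewrite !bopE !ipE.
Qed.

Lemma kantorovich_upper (A : bop H) m M g : spd A -> 0 < g -> g ^+ 2 = M * m ->
  lower_bound A m -> upper_bound A M ->
  upper_bound ((2^-1)%:C *: ((g^-1)%:C *: A + g%:C *: (A ^op (-1))))
              ((M + m) / (2 * g)).
Proof.
move=> Aspd g0 g2 Am AM.
have A1 : is_fun_calc (fun t => t `^ (-1)) A (A ^op (-1)).
  by apply: pow_fun_calc => //; lra.
apply: fun_calc_upper Aspd.1 (fun_calcZ 2^-1
  (fun_calcD (fun_calcZ g^-1 (fun_calc_id A)) (fun_calcZ g A1))) _ => t At.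
have t0 := rspec_gt0 Aspd At.
have mt := spectrum_ge Aspd.1 Am At; have tM := spectrum_le Aspd.1 AM At.
rewrite powR_inv1 ?(ltW t0)// invfM mulrCA ler_pM2l ?invr_gt0//.
rewrite ler_pdivlMr// -(ler_pM2r t0).
have -> : (g^-1 * t + g / t) * g * t = t ^+ 2 + g ^+ 2.
  by field; rewrite !gt_eqF.
by rewrite g2; nra.
Qed.

Lemma spd_normalized (Phi : {linear bop H -> bop H}) T :
  positive_map Phi -> normalized_map Phi -> spd T -> spd (Phi T).
Proof.
move=> Phi0 Phi1 Tspd; have [Tsa [d d0 Td]] := Tspd.
have Psa : sa (Phi T) by apply/bop_pos_sa/Phi0/spd_bop_pos.
split=> //; exists d => //; apply/(bop_le_scalar_lower _ Psa).
rewrite -(normalized_scalar d Phi1); apply: positive_map_le => //.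
exact/(bop_le_scalar_lower _ Tsa).
Qed.

Lemma powR_sqrt_half a r : 0 < a -> Num.sqrt a `^ r = a `^ (r / 2).
Proof. by move=> a0; rewrite -powR12_sqrt ?(ltW a0)// -powRrM mulrC. Qed.

Lemma powR_inv_base a r : 0 < a -> a^-1 `^ r = (a `^ r)^-1.
Proof. by move=> a0; rewrite -powR_inv1 ?(ltW a0)// -powRrM mulN1r powRN. Qed.

End KantorovichBound.

Unset Implicit Arguments.

Theorem corollary2p3 (R : realType) (H : hilbertType R) (A : bop H) (m M : R)
    (Phi : {linear bop H -> bop H}) :
  bop_pos A -> 0 < m -> m < M ->
  bop_scalar H m <=op A -> A <=op bop_scalar H M ->
  positive_map Phi -> normalized_map Phi ->
  let g := Num.sqrt (M * m) in
  let c := (M + m) / (2 * g) in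
  let P := Phi A in
  let Q := Phi (bop_inv A) in
  let X := (2^-1)%:C *: ((g^-1)%:C *: P + g%:C *: Q) in
  [/\ (forall r : R, 0 <= r -> r <= 1 ->
        [/\ X ^op r <=op bop_scalar H (c `^ r),
            (2^-1)%:C *: ((((M * m) `^ (r / 2))^-1)%:C *: (P ^op r)
                          + ((M * m) `^ (r / 2))%:C *: (Q ^op r))
              <=op X ^op r
          & (P ^op r) #op (Q ^op r) <=op
            (2^-1)%:C *: ((((M * m) `^ (r / 2))^-1)%:C *: (P ^op r)
                          + ((M * m) `^ (r / 2))%:C *: (Q ^op r))]),
      X <=op bop_scalar H c /\ P #op Q <=op X
    & (forall r : R, -1 <= r -> r <= 0 ->
        [/\ bop_scalar H (c `^ r) <=op X ^op r,
            X ^op r <=op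
            bop_inv ((2 * (M * m) `^ (r / 2))^-1%:C *:
              (((M * m) `^ r)%:C *: (P ^op (- r)) + Q ^op (- r)))
          & bop_inv ((2 * (M * m) `^ (r / 2))^-1%:C *:
              (((M * m) `^ r)%:C *: (P ^op (- r)) + Q ^op (- r)))
              <=op (P ^op r) #op (Q ^op r)])].
Proof.
move=> Apos m0 mM mA AM Phi0 Phi1 g c P Q X.
have Asa := bop_pos_sa Apos.
have {mA} Am : lower_bound A m by exact/bop_le_scalar_lower.
have {AM} AM : upper_bound A M by exact/bop_le_scalar_upper.
have Aspd : spd A by split=> //; exists m.
have Mm0 : 0 < M * m by rewrite mulr_gt0// (lt_trans m0).
have g0 : 0 < g by rewrite sqrtr_gt0.
have g2 : g ^+ 2 = M * m by rewrite sqr_sqrtr// ltW.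
have gV0 : 0 < g^-1 by rewrite invr_gt0.
have gE r : g `^ r = (M * m) `^ (r / 2) by exact: powR_sqrt_half.
have gVE r : g^-1 `^ r = ((M * m) `^ (r / 2))^-1.
  by rewrite powR_inv_base// gE.
have A1spd : spd (A ^op (-1)) by apply: pow_spd => //; lra.
have QE : Q = Phi (A ^op (-1)) by rewrite /Q pow_invE.
have Pspd : spd P by exact: spd_normalized.
have Qspd : spd Q by rewrite QE; exact: spd_normalized.
have Xspd : spd X by exact: spd_mean.
have Xc : upper_bound X c.
  apply/(bop_le_scalar_upper _ Xspd.1).
  rewrite -(normalized_scalar c Phi1).
  have -> : X = Phi ((2^-1)%:C *: ((g^-1)%:C *: A + g%:C *: (A ^op (-1)))).
    by rewrite linearZ linearD !linearZ /X QE.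
  apply: positive_map_le => //; apply/bop_le_scalar_upper.
    by case: (spd_mean gV0 g0 Aspd A1spd).
  exact: kantorovich_upper.
have concave r x : 0 <= r <= 1 ->
    2^-1 * (((M * m) `^ (r / 2))^-1 * ip ((P ^op r) x) x
          + (M * m) `^ (r / 2) * ip ((Q ^op r) x) x) <= ip ((X ^op r) x) x.
  by move=> r01; have := pow_concave x gV0 g0 Pspd Qspd r01; rewrite gVE gE.
have k0 r : 0 < (M * m) `^ r by exact: powR_gt0.
have XE x : ip (X x) x = 2^-1 * (g^-1 * ip (P x) x + g * ip (Q x) x).
  by rewrite !bopE !ipE.
clearbody P Q X; split.
- move=> r r0 r1.
  have r01 : 0 <= r <= 1 by rewrite r0.
  have r11 : -1 <= r <= 1 by lra.
  have Prs := pow_spd Pspd r11; have Qrs := pow_spd Qspd r11.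
  have Xrs := pow_spd Xspd r11.
  have kV0 : 0 < ((M * m) `^ (r / 2))^-1 by rewrite invr_gt0.
  have Ysa := (spd_mean kV0 (k0 (r / 2)) Prs Qrs).1.
  split.
  + by apply/(bop_le_scalar_upper _ Xrs.1); exact: pow_upper.
  + by apply/(bop_leP Ysa Xrs.1) => x; rewrite !bopE !ipE; exact: concave.
  + have [G' [Gs _ G _]] := geometric_mean_bounds Prs Qrs
      (pow_inverse Pspd r11) (pow_inverse Qspd r11).
    by apply/(bop_leP Gs.1 Ysa) => x; rewrite !bopE !ipE; exact: G.
- have one : -1 <= (1 : R) <= 1 by lra.
  split; first by apply/(bop_le_scalar_upper _ Xspd.1).
  have PV := pow_inverse Pspd one; rewrite pow1// in PV.
  have QV := pow_inverse Qspd one; rewrite pow1// in QV.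
  have [G' [Gs _ G _]] := geometric_mean_bounds Pspd Qspd PV QV.
  by apply/(bop_leP Gs.1 Xspd.1) => x; rewrite XE; exact: G.
- move=> r r1 r0.
  have r10 : -1 <= r <= 0 by rewrite r1.
  have r11 : -1 <= r <= 1 by lra.
  have n01 : 0 <= - r <= 1 by lra.
  have n11 : -1 <= - r <= 1 by lra.
  have Prs := pow_spd Pspd r11; have Qrs := pow_spd Qspd r11.
  have Xrs := pow_spd Xspd r11.
  have Pns := pow_spd Pspd n11; have Qns := pow_spd Qspd n11.
  have Xns := pow_spd Xspd n11.
  have Pinv := pow_inverse Pspd r11; have Qinv := pow_inverse Qspd r11.
  have Xinv := bop_inverse_sym (pow_inverse Xspd r11).
  set Y := ((2 * _)^-1)%:C *: _.
  pose k := (M * m) `^ (r / 2).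
  have kpos : 0 < k := k0 _.
  have kV0 : 0 < k^-1 by rewrite invr_gt0.
  have kk : k * k = (M * m) `^ r by apply: powR_addE => //; lra.
  have YE : Y = (2^-1)%:C *:
      (k%:C *: (P ^op (- r)) + (k^-1)%:C *: (Q ^op (- r))).
    rewrite /Y -/k -kk !scalerDr !scalerA -!rmorphM.
    congr (_%:C *: _ + _%:C *: _).
      by field; rewrite gt_eqF.
    by rewrite invfM.
  clearbody Y.
  have Yspd : spd Y by rewrite YE; exact: spd_mean.
  have [Y' YY'] := spd_invertible Yspd.
  have Y'sa := sa_inverse YY' Yspd.1.
  have YQ x : ip (Y x) x =
      2^-1 * (k * ip ((P ^op (- r)) x) x + k^-1 * ip ((Q ^op (- r)) x) x).
    by rewrite YE !bopE !ipE.
  rewrite (bop_invE YY'); split.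
  + by apply/(bop_le_scalar_lower _ Xrs.1); exact: pow_lower.
  + apply/(bop_leP Xrs.1 Y'sa).
    apply: (inverse_antitone Yspd.1 _ Xns.1 _ YY' Xinv).
      by have [] := (bop_posP Y).1 (spd_bop_pos Yspd).
    move=> x; have := concave (- r) x n01; rewrite YQ mulNr powRN invrK.
    exact.
  + have [G' [Gs GG' _ G]] := geometric_mean_bounds Prs Qrs Pinv Qinv.
    have G'sa := sa_inverse GG' Gs.1.
    apply/(bop_leP Y'sa Gs.1).
    apply: (inverse_antitone G'sa (inverse_psd Gs GG') Yspd.1 _
              (bop_inverse_sym GG') YY').
    by move=> x; rewrite YQ; have := G k^-1 x kV0; rewrite invrK.
Qed.
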